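(* Let $n\ge2$ and let $\mathcal{ST}_n$ be the arrangement in $\mathbb{R}^n$ with hyperplanes $x_i+x_j=-1,0$ for all $1\le i<j\le n$. A symmetric sketch (an order on the letters of $C(n)$) is $\mathcal{ST}$ maximal if and only if the following hold. (1) If a $\beta$-letter is immediately followed by an $\alpha$-letter, then the $\beta$-letter is negative, the $\alpha$-letter is positive, and they have different mod-values. (2) If two $\alpha$-letters are consecutive, their corresponding $\beta$-letters are also consecutive, and they are of the same sign, then the subscript of the first one is greater than that of the second. (3) If the $n$-th and $(n+1)$-th $\alpha$-letters are consecutive, then so are the $(n-1)$-th and $n$-th $\alpha$-letters, and the $n$-th $\alpha$-letter is positive. In such a situation, if the $(n-1)$-th $\alpha$-letter is negative and the $(n-1)$-th and $n$-th $\beta$-letters are consecutive, then the $(n-1)$-th $\alpha$-letter has a subscript greater than that of the $(n+1)$-th $\alpha$-letter. (4) If the $(2n-1)$-th and $(2n+1)$-th letters of the sketch are both negative $\beta$-letters and their corresponding $\alpha$-letters are consecutive, then the subscript of the $(2n-1)$-th letter is greater than that of the $(2n+1)$-th letter. Hence the regions of $\mathcal{ST}_n$ are in bijection with the symmetric sketches satisfying (1)–(4).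
   Context: $\mathcal{ST}_n$ is the translate (by $X_i=x_i+\tfrac12$) of the Shi threshold arrangement $X_i+X_j=0,1$. A region of an arrangement is a connected component of the complement of the union of its hyperplanes. $[n]=\{1,\dots,n\}$. Let $C(n)$ be the set of $4n$ letters $\alpha_i^{(s)}$ and $\alpha_{-i}^{(-s)}$ with $i\in[n]$, $s\in\{0,1\}$, representing $x_i+s$ and $-x_i-s$ respectively. The conjugate of $\alpha_i^{(s)}\in C(n)$ is $\overline{\alpha_i^{(s)}}=\alpha_{-i}^{(-s)}$. A symmetric sketch is a total order on $C(n)$ (a word $w_1\cdots w_{4n}$ using each letter once) such that, whenever the letters involved belong to $C(n)$: (i) if $\alpha_i^{(s)}$ appears before $\alpha_j^{(t)}$ then $\overline{\alpha_j^{(t)}}$ appears before $\overline{\alpha_i^{(s)}}$; (ii) if $\alpha_i^{(s-1)}$ appears before $\alpha_j^{(t-1)}$ then $\alpha_i^{(s)}$ appears before $\alpha_j^{(t)}$; (iii) $\alpha_i^{(s-1)}$ appears before $\alpha_i^{(s)}$. Symmetric sketches correspond bijectively to the regions of the arrangement $\mathcal{C}_n$ in $\mathbb{R}^n$ with hyperplanes $2x_i=-2,-1,0$ ($i\in[n]$), $x_i+x_j=-2,-1,0$, $x_i-x_j=-1,0,1$ ($1\le i<j\le n$): a sketch corresponds to the region of points for which the represented real numbers are strictly increasing along the word. The $\alpha$-letters are $\alpha_i^{(0)}$ and $\alpha_{-i}^{(-1)}$ ($i\in[n]$); the other letters are $\beta$-letters. The $\beta$-letter corresponding to an $\alpha$-letter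 (and vice versa) is the one with the same subscript. A letter is positive or negative according to the sign of its subscript; the mod-value of $\alpha_i^{(s)}$ is $|i|$. ''Consecutive'' means in adjacent positions of the word. Two symmetric sketches are $\mathcal{ST}$ equivalent if their regions of $\mathcal{C}_n$ lie in the same region of $\mathcal{ST}_n$. Sketches are compared in the lexicographic order induced by the order on letters $$\alpha_n^{(0)}\succ\cdots\succ\alpha_1^{(0)}\succ\alpha_{-1}^{(-1)}\succ\cdots\succ\alpha_{-n}^{(-1)}\succ\alpha_n^{(1)}\succ\cdots\succ\alpha_1^{(1)}\succ\alpha_{-1}^{(0)}\succ\cdots\succ\alpha_{-n}^{(0)}.$$ A sketch is $\mathcal{ST}$ maximal if it is greater than all other sketches to which it is $\mathcal{ST}$ equivalent. *)

(* Defs.v *)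
From mathcomp Require Import all_boot all_order all_algebra.
From mathcomp Require Import all_classical all_reals all_analysis.

Set Implicit Arguments.
Unset Strict Implicit.
Unset Printing Implicit Defensive.

Import Order.TTheory GRing.Theory Num.Theory.
Import numFieldNormedType.Exports.

Local Open Scope classical_set_scope.
Local Open Scope ring_scope.

(** Coordinates are indexed by ['I_n], so that [i : 'I_n] stands for the
    element [i.+1] of {1, ..., n}. *)

Section Arrangements.
Context {R : realType} {n : nat}.

Definition arr_complement (A : set (set 'rV[R]_n)) : set 'rV[R]_n :=
  ~` \bigcup_(H in A) H.

Definition regions (A : set (set 'rV[R]_n)) : set (set 'rV[R]_n) :=
  [set C | exists2 x, arr_complement A x
                    & C = connected_component (arr_complement A) x].

End Arrangements.

Definition ST_arr (R : realType) (n : nat) : set (set 'rV[R]_n) :=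
  [set H | exists (i j : 'I_n) (c : R),
     [/\ (i < j)%N, c = -1 \/ c = 0
       & H = [set x : 'rV[R]_n | x 0 i + x 0 j = c]]].

Arguments ST_arr : clear implicits.

(** [(i, neg, s)] is the letter alpha_(i+1)^(s) if [neg] is false and
    alpha_(-(i+1))^(-s) if [neg] is true; [s] is read as 0 or 1. *)
Definition letter (n : nat) : Type := ('I_n * bool * bool)%type.

Section Sketches.
Context {n : nat}.
Implicit Types a b c d : letter n.

Definition negative a : bool := a.1.2.
Definition positive a : bool := ~~ negative a.
Definition mod_value a : nat := (a.1.1).+1.
Definition subscript a : int :=
  if negative a then - (mod_value a)%:Z else (mod_value a)%:Z.
Definition superscript a : int :=
  if negative a then - (a.2 : nat)%:Z else (a.2 : nat)%:Z.

Definition conjugate a : letter n := (a.1.1, ~~ a.1.2, a.2).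

Definition is_alpha a : bool :=
  (positive a && (superscript a == 0)) || (negative a && (superscript a == -1)).
Definition is_beta a : bool := ~~ is_alpha a.

Definition corresponding a : letter n := (a.1, ~~ a.2).

Definition word := (4 * n).-tuple (letter n).
Implicit Types w : word.

Definition before w a b : bool := (index a w < index b w)%N.
Definition followed_by w a b : bool := index b w == (index a w).+1.
Definition consecutive w a b : bool := followed_by w a b || followed_by w b a.

Definition total_order_word w : Prop := forall a, count_mem a w = 1%N.

Definition symmetric_sketch w : Prop :=
  [/\ total_order_word w,
      forall a b, before w a b -> before w (conjugate b) (conjugate a),
      forall a a' b b',
        subscript a' = subscript a -> superscript a' = superscript a + 1 ->
        subscript b' = subscript b -> superscript b' = superscript b + 1 ->
        before w a b -> before w a' b'
    & forall a a',
        subscript a' = subscript a -> superscript a' = superscript a + 1 ->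
        before w a a'].

(** The order on letters: every alpha-letter is above every beta-letter, and
    letters of the same kind are ordered by subscript. *)
Definition letter_key a : bool *l int := (is_alpha a, subscript a).

Definition sketch_lt w1 w2 : bool :=
  (([seq letter_key a | a <- w1] : seqlexi (bool *l int)) <
   ([seq letter_key a | a <- w2] : seqlexi (bool *l int)))%O.

(** [is_kth s k a]: [a] is the [k]-th item of [s], counting from 1. *)
Definition is_kth (s : seq (letter n)) (k : nat) a : Prop :=
  (0 < k)%N /\ onth s k.-1 = Some a.

Definition kth_letter w k a : Prop := is_kth w k a.
Definition kth_alpha w k a : Prop := is_kth [seq c <- w | is_alpha c] k a.
Definition kth_beta w k a : Prop := is_kth [seq c <- w | is_beta c] k a.

Definition condition1 w : Prop :=
  forall b a, is_beta b -> is_alpha a -> followed_by w b a ->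
    [/\ negative b, positive a & mod_value b <> mod_value a].

Definition condition2 w : Prop :=
  forall a1 a2, is_alpha a1 -> is_alpha a2 -> followed_by w a1 a2 ->
    consecutive w (corresponding a1) (corresponding a2) ->
    negative a1 = negative a2 ->
    subscript a2 < subscript a1.

Definition condition3 w : Prop :=
  forall a_pred a_n a_succ,
    kth_alpha w n.-1 a_pred -> kth_alpha w n a_n -> kth_alpha w n.+1 a_succ ->
    consecutive w a_n a_succ ->
    [/\ consecutive w a_pred a_n,
        positive a_n
      & forall b_pred b_n,
          kth_beta w n.-1 b_pred -> kth_beta w n b_n ->
          negative a_pred -> consecutive w b_pred b_n ->
          subscript a_succ < subscript a_pred].

Definition condition4 w : Prop :=
  forall b1 b2,
    kth_letter w (2 * n - 1) b1 -> kth_letter w (2 * n + 1) b2 ->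
    is_beta b1 -> negative b1 -> is_beta b2 -> negative b2 ->
    consecutive w (corresponding b1) (corresponding b2) ->
    subscript b2 < subscript b1.

Definition ST_conditions w : Prop :=
  [/\ condition1 w, condition2 w, condition3 w & condition4 w].

End Sketches.

Arguments word : clear implicits.

Section Maximality.
Context (R : realType) (n : nat).
Implicit Types (w : word n) (x : 'rV[R]_n).

(** alpha_i^(s) represents x_i + s and its conjugate represents - x_i - s. *)
Definition letter_value x (a : letter n) : R :=
  let v := x 0 a.1.1 + (a.2 : nat)%:R in if negative a then - v else v.

(** The region of the arrangement C_n corresponding to the sketch [w]. *)
Definition sketch_region w : set 'rV[R]_n :=
  [set x | sorted <%R [seq letter_value x a | a <- w]].

Definition ST_equivalent w1 w2 : Prop :=
  exists2 C, regions (ST_arr R n) C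
           & sketch_region w1 `<=` C /\ sketch_region w2 `<=` C.

Definition ST_maximal w : Prop :=
  forall w', symmetric_sketch w' -> ST_equivalent w w' -> w' <> w ->
    sketch_lt w' w.

End Maximality.

Arguments sketch_region R {n} w.
Arguments ST_equivalent R {n} w1 w2.
Arguments ST_maximal R {n} w.

(* Main.v *)
(** Put [y_i = x_i + 1/2] and [y_(-i) = - y_i]; then the alpha-letter with
    subscript [k] has value [y_k - 1/2], its beta-letter has value [y_k + 1/2],
    and conjugation reverses the word.  A sketch is thus a symmetric semiorder
    on the [y_k]; it is realized by choosing values from left to right with
    beta = alpha + 1 and averaging with the mirror image.  Regions of [ST_n] are
    convex sign classes, so two sketches are equivalent iff they agree on the
    relative order of every positive alpha-letter and every negative letter of a
    different mod-value.

    If one of (1)-(4) fails, then exchanging an irrelevant beta-alpha pair, or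
    two subscripts whose letters are nearly adjacent (or both, in (3)), gives a
    larger equivalent sketch.  Conversely, suppose [w] satisfies (1)-(4) and an
    equivalent [w'] exceeds it, and at the first difference let [w'] have the
    alpha-letter with subscript [b].  By (1) and (3), [w] has only alpha-letters
    from that place up to this letter, and by (2)-(4) all their subscripts
    (except possibly [-b]) exceed [b], whereas the first should be below [b]. *)

Require Import Defs.
From mathcomp Require Import all_boot all_order all_algebra.
From mathcomp Require Import zify lra ring.
From mathcomp Require Import all_classical all_reals all_analysis.

Set Implicit Arguments.
Unset Strict Implicit.
Unset Printing Implicit Defensive.

Import Order.TTheory GRing.Theory Num.Theory.
Import numFieldNormedType.Exports.

Local Open Scope classical_set_scope.
Local Open Scope ring_scope.

(** * Letters in terms of signed indices *)

Section Letters.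
Context {n : nat}.
Implicit Types (a b : letter n) (k l : 'I_n * bool).

(** The alpha- and the beta-letter with signed index [k = (i, neg)], that is with
    subscript [i+1] or [-(i+1)]. *)
Definition al k : letter n := (k, k.2).
Definition be k : letter n := (k, ~~ k.2).
Definition sopp k : 'I_n * bool := (k.1, ~~ k.2).

Lemma soppK : involutive sopp.
Proof. by case=> i s; rewrite /sopp /= negbK. Qed.

Lemma sopp_neq k : sopp k <> k.
Proof. by case: k => i [] []. Qed.

Lemma conjugateK : involutive (@conjugate n).
Proof. by case=> [[i s] t]; rewrite /conjugate /= negbK. Qed.

Lemma conjugate_al k : conjugate (al k) = be (sopp k).
Proof. by case: k => i s; rewrite /conjugate /al /be /sopp /= negbK. Qed.

Lemma conjugate_be k : conjugate (be k) = al (sopp k).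
Proof. by []. Qed.

Lemma is_alphaE a : is_alpha a = (a.1.2 == a.2).
Proof. by case: a => [[i []] []]. Qed.

Lemma is_alpha_al k : is_alpha (al k).
Proof. by rewrite is_alphaE /= eqxx. Qed.

Lemma is_alpha_be k : is_alpha (be k) = false.
Proof. by rewrite is_alphaE /=; case: k => ? []. Qed.

Lemma is_alpha_conjugate a : is_alpha (conjugate a) = ~~ is_alpha a.
Proof. by case: a => [[i []] []]. Qed.

Lemma letterP a : a = if is_alpha a then al a.1 else be a.1.
Proof. by case: a => [[i []] []]. Qed.

(** Destructing [alphaP] replaces a letter by [al k] or [be k] and evaluates [is_alpha] on it at the
    same time. *)
Variant alpha_spec : letter n -> bool -> Type :=
  | IsAlpha k : alpha_spec (al k) true
  | IsBeta k : alpha_spec (be k) false.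

Lemma alphaP a : alpha_spec a (is_alpha a).
Proof. by rewrite [a]letterP; case: ifP => _; rewrite ?is_alpha_al ?is_alpha_be; constructor. Qed.

Lemma al_be k l : al k <> be l.
Proof. by move=> E; have := is_alpha_al k; rewrite E is_alpha_be. Qed.

Lemma al_inj : injective al. Proof. by move=> k l []. Qed.
Lemma be_inj : injective be. Proof. by move=> k l []. Qed.

Lemma subscript_inj k l : subscript (al k) = subscript (al l) -> k = l.
Proof.
case: k l => i [] [j []]; rewrite /subscript /negative /mod_value /= => H;
  first [by congr (_, _); apply: val_inj => /=; lia | lia].
Qed.

Lemma subscript_sopp k : subscript (al (sopp k)) = - subscript (al k).
Proof. by case: k => i []; rewrite /subscript /negative /mod_value /= ?opprK. Qed.

(** Each subscript carries only two superscripts, the lower one on the alpha-letter, so raising the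
    superscript by 1 always leads from [al k] to [be k]. *)
Lemma succ_superscriptP a a' :
  subscript a' = subscript a -> superscript a' = superscript a + 1 ->
  exists2 k, a = al k & a' = be k.
Proof.
case: a a' => [[i s] t] [[i' s'] t'] H1 H2.
have [E1 E2] : (i', s') = (i, s) by apply: subscript_inj.
move: H2; rewrite E1 E2 /superscript /negative /= => H2.
by exists (i, s); case: (s) (t) (t') H2 => [] [] [].
Qed.

Lemma superscript_be k : superscript (be k) = superscript (al k) + 1.
Proof. by case: k => i []. Qed.

Lemma letter_key_inj : injective (@letter_key n).
Proof.
move=> a b [Ea Es]; rewrite (letterP a) (letterP b) Ea.
have -> // : a.1 = b.1.
by apply: subscript_inj.
Qed.

Lemma card_letter : #|{: letter n}| = (4 * n)%N.
Proof. by rewrite !card_prod card_bool card_ord; lia. Qed.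

(** The pairs whose order is decided by a hyperplane [x_i + x_j = 0, -1] of
    [ST_n]; pairs of a positive beta-letter and a negative letter are not
    among them. *)
Definition relevant a b : bool :=
  [&& is_alpha a, positive a, negative b & a.1.1 != b.1.1].

End Letters.

(** * Ranking functions on finite types *)

Section Rank.
Context {T : finType} (p : T -> nat).
Hypothesis p_inj : injective p.
Hypothesis p_lt : forall x, (p x < #|T|)%N.

Lemma rank_surj j : (j < #|T|)%N -> exists x, p x = j.
Proof.
move=> hj; pose q x := Ordinal (p_lt x).
have q_inj : injective q by move=> x y /(congr1 val) /= /p_inj.
have /codomP [x /(congr1 val) /= ->] : Ordinal hj \in codom q.
  by rewrite inj_card_onto // card_ord.
by exists x.
Qed.

(** By [rank_surj] the values of [p] are all the numbers below [#|T|], so exactly [p x] of them lie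
    below [p x]. *)
Lemma rankE x : p x = #|[pred y | (p y < p x)%N]|.
Proof.
have E : perm_eq (map p (enum T)) (iota 0 #|T|).
  apply: uniq_perm; [|exact: iota_uniq|].
    by rewrite map_inj_uniq //; exact: enum_uniq.
  move=> j; rewrite mem_iota /= add0n; apply/mapP/idP.
    by case=> y _ ->.
  by move=> /rank_surj [y <-]; exists y; rewrite ?mem_enum.
rewrite enumT in E; rewrite cardE size_filter -(count_map p (fun j => (j < p x)%N)).
rewrite (permP E) -size_filter -[LHS](size_iota 0).
congr size; have := p_lt x; move: (p x) => m hm.
rewrite -(subnKC (ltnW hm)) iotaD filter_cat.
rewrite (_ : seq.filter _ (iota 0 m) = iota 0 m); last first.
  by apply/all_filterP/allP => j; rewrite mem_iota.
rewrite (_ : seq.filter _ _ = [::]) ?cats0 //.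
by apply/eqP; rewrite -[_ == _]negbK -has_filter; apply/hasPn => j; rewrite mem_iota; lia.
Qed.

(** The elements ranked below [f x] are the images of those ranked above [x], and the elements above
    or below [x] are all but [x] itself. *)
Lemma rank_reverse (f : T -> T) :
  injective f -> (forall x y, (p x < p y)%N -> (p (f y) < p (f x))%N) ->
  forall x, (p x + p (f x))%N = #|T|.-1.
Proof.
move=> f_inj f_rev x.
have card_gt0 : (0 < #|T|)%N by apply/card_gt0P; exists x.
suff : (#|[pred y | (p y < p x)%N]| + #|[pred y | (p y < p (f x))%N]|)%N = #|predC1 x|.
  by rewrite -!rankE cardC1.
have E : #|[pred y | (p y < p (f x))%N]| = #|[pred y | (p x < p y)%N]|.
  rewrite -[RHS](fintype.card_image f_inj); apply: eq_card => z; rewrite !inE.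
  have [y ->] : exists y, z = f y by exists (invF f_inj z); rewrite f_invF.
  rewrite fintype.mem_image // !inE.
  case: (ltngtP (p x) (p y)) => [/f_rev -> //|/f_rev h|/p_inj ->].
    by apply/negbTE; rewrite -leqNgt ltnW.
  by rewrite ltnn.
rewrite E -cardUI (eq_card (B := predC1 x)); last first.
  by move=> z; rewrite !inE -(inj_eq p_inj); case: ltngtP.
rewrite [X in (_ + X)%N]eq_card0 ?addn0 // => z; rewrite !inE.
by case: ltngtP.
Qed.

End Rank.

(** * Positions in a sketch *)

Section Words.
Context {n : nat}.
Implicit Types (w : word n) (a b : letter n) (k l : 'I_n * bool).

Lemma total_order_mem w : total_order_word w -> forall a, a \in tval w.
Proof. by move=> tw a; rewrite -has_pred1 has_count tw. Qed.

Lemma total_order_uniq w : total_order_word w -> uniq w.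
Proof.
move=> tw; apply: count_mem_uniq => a; rewrite tw.
by rewrite (total_order_mem tw).
Qed.

Lemma index_lt w : total_order_word w -> forall a, (index a w < #|{: letter n}|)%N.
Proof.
by move=> tw a; rewrite card_letter -[X in (_ < X)%N](size_tuple w) index_mem (total_order_mem tw).
Qed.

Lemma index_injective w : total_order_word w -> injective (fun a => index a w).
Proof. by move=> tw a b; apply: seq.index_inj => //; apply: total_order_mem tw _. Qed.

(** By [succ_superscriptP], requirements (ii) and (iii) of a sketch only compare alpha-letters with
    their corresponding beta-letters. *)
Lemma sketchE w : symmetric_sketch w <->
  [/\ total_order_word w,
      forall a b, before w a b -> before w (conjugate b) (conjugate a),
      forall k l, before w (al k) (al l) -> before w (be k) (be l)
    & forall k, before w (al k) (be k)].
Proof.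
split=> [[tw cw mw sw]|[tw cw mw sw]].
  split=> // [k l|k]; last by apply: sw => //; exact: superscript_be.
  by apply: mw => //; exact: superscript_be.
split=> // [a a' b b'|a a'].
  move=> sa ta sb tb; have [k -> ->] := succ_superscriptP sa ta.
  by have [l -> ->] := succ_superscriptP sb tb; exact: mw.
by move=> sa ta; have [k -> ->] := succ_superscriptP sa ta.
Qed.

Lemma is_kthP (s : seq (letter n)) m a : uniq s ->
  is_kth s m a <-> a \in s /\ m = (index a s).+1.
Proof.
move=> us; rewrite /is_kth; split=> [[m_gt0 sm]|[sa ->]]; last first.
  by rewrite /= onthE (nth_map a) ?index_mem // nth_index.
have ms : (m.-1 < size s)%N by rewrite -onthTE sm.
split; first by apply/onthP; exists m.-1.
by rewrite -{1}(onth_nth a a s m.-1 sm) index_uniq // prednK.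
Qed.

Lemma index_filterE (s : seq (letter n)) (P : pred (letter n)) a :
  uniq s -> P a -> index a [seq x <- s | P x] = count P (take (index a s) s).
Proof.
move=> us Pa; elim: s us => [//|b s IH] /= /andP [bs us].
case: eqVneq => [->|ba]; first by rewrite Pa /= eqxx.
by case: ifP => Pb /=; rewrite ?(negbTE ba) Pb IH.
Qed.

Lemma index_filter_card w (P : pred (letter n)) a : total_order_word w -> P a ->
  index a [seq x <- w | P x] = #|[pred x | P x && before w x a]|.
Proof.
move=> tw Pa; have uw := total_order_uniq tw.
rewrite index_filterE // -size_filter.
rewrite -(card_uniqP _); last by rewrite filter_uniq // take_uniq.
apply: eq_card => x; rewrite !inE mem_filter in_take //.
exact: total_order_mem.
Qed.

Lemma kth_letterP w m a : total_order_word w ->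
  kth_letter w m a <-> m = (index a w).+1.
Proof.
move=> tw; rewrite /kth_letter is_kthP; last exact: total_order_uniq.
by split=> [[]//|]; split=> //; exact: total_order_mem.
Qed.

(** Ranks count from 0: the [m]-th alpha-letter has rank [m - 1]. *)
Definition rk w k := #|[pred l | before w (al l) (al k)]|.

Lemma kth_alphaP w m a : total_order_word w ->
  kth_alpha w m a <-> is_alpha a /\ m = (rk w a.1).+1.
Proof.
move=> tw; rewrite /kth_alpha is_kthP; last exact/filter_uniq/total_order_uniq.
rewrite mem_filter total_order_mem // andbT.
suff E : is_alpha a -> index a [seq c <- w | is_alpha c] = rk w a.1.
  by split=> -[aa ->]; rewrite E.
case: (alphaP a) => // k _; rewrite index_filter_card ?is_alpha_al //.
rewrite /rk -(fintype.card_image al_inj); apply: eq_card => x; rewrite !inE.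
case: (alphaP x) => l /=; last by apply/esym/fintype.imageP => -[m' _ /esym/al_be].
by rewrite fintype.mem_image ?inE //; exact: al_inj.
Qed.

Section Sketch.
Variable w : word n.
Hypothesis sw : symmetric_sketch w.
Local Notation p a := (index a w).

Lemma sketch_total : total_order_word w. Proof. by case: sw. Qed.

Lemma pos_inj : injective (fun a => p a).
Proof. exact: index_injective sketch_total. Qed.

Lemma pos_lt a : (p a < 4 * n)%N.
Proof. by have := index_lt sketch_total a; rewrite card_letter. Qed.

Lemma pos_surj j : (j < 4 * n)%N -> exists a, p a = j.
Proof.
move=> hj; apply: (rank_surj pos_inj (index_lt sketch_total)).
by rewrite card_letter.
Qed.

(** Conjugation reverses the positions, which run from 0 to 4n - 1. Most of the position arithmetic
    below rests on this identity. *)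
Lemma pos_conjugate a : (p a + p (conjugate a))%N = (4 * n).-1.
Proof.
have [_ cw _ _] := sw.
have := rank_reverse pos_inj (index_lt sketch_total) (inv_inj conjugateK) cw a.
by rewrite card_letter.
Qed.

Lemma pos_be_opp k : (p (al k) + p (be (sopp k)))%N = (4 * n).-1.
Proof. by rewrite -conjugate_al pos_conjugate. Qed.

Lemma pos_al_opp k : (p (al (sopp k)) + p (be k))%N = (4 * n).-1.
Proof. by have := pos_be_opp (sopp k); rewrite soppK. Qed.

Lemma pos_al_be k : (p (al k) < p (be k))%N.
Proof. by have /sketchE [_ _ _] := sw; apply. Qed.

Lemma pos_mono k l : (p (al k) < p (al l))%N = (p (be k) < p (be l))%N.
Proof.
have /sketchE [_ _ mw _] := sw.
have sub k' l' : (p (al k') < p (al l'))%N -> (p (be k') < p (be l'))%N by exact: mw.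
case: (ltngtP (p (al k)) (p (al l))) => [/sub -> //|/sub h|/pos_inj/al_inj ->].
  by apply/esym/negbTE; rewrite -leqNgt ltnW.
by rewrite ltnn.
Qed.

Lemma pos_al_neq k l : k <> l -> p (al k) <> p (al l).
Proof. by move=> kl /pos_inj/al_inj. Qed.

Lemma pos_be_neq k l : k <> l -> p (be k) <> p (be l).
Proof. by move=> kl /pos_inj/be_inj. Qed.

Lemma pos_al_be_neq k l : p (al k) <> p (be l).
Proof. by move=> /pos_inj/al_be. Qed.

(** By [pos_mono] the beta-letters come in the order of their alpha-letters, so [rk] counts them as
    well. *)
Lemma kth_betaP m b : kth_beta w m b <-> is_beta b /\ m = (rk w b.1).+1.
Proof.
have tw := sketch_total.
rewrite /kth_beta is_kthP; last exact/filter_uniq/total_order_uniq.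
rewrite mem_filter total_order_mem // andbT.
suff E : is_beta b -> index b [seq c <- w | is_beta c] = rk w b.1.
  by split=> -[bb ->]; rewrite E.
rewrite /is_beta; case: (alphaP b) => // k _.
rewrite (index_filter_card (P := fun c => ~~ is_alpha c)) ?is_alpha_be //.
rewrite /rk -(fintype.card_image be_inj); apply: eq_card => x; rewrite !inE.
case: (alphaP x) => l /=; first by apply/esym/fintype.imageP => -[m' _ /al_be].
by rewrite fintype.mem_image ?inE /before /= -?pos_mono //; exact: be_inj.
Qed.

Lemma rk_lt k : (rk w k < 2 * n)%N.
Proof.
have -> : (2 * n)%N = #|{: 'I_n * bool}| by rewrite card_prod card_bool card_ord mulnC.
apply: proper_card; apply/properP; split; first exact/fintype.subsetP.
by exists k; rewrite ?inE // /before ltnn.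
Qed.

Lemma rk_mono k l : (p (al k) < p (al l))%N -> (rk w k < rk w l)%N.
Proof.
move=> kl; apply: proper_card; apply/properP; split.
  by apply/fintype.subsetP => x; rewrite !inE /before => /ltn_trans; apply.
by exists k; rewrite ?inE // /before ltnn.
Qed.

Lemma rk_ltE k l : (rk w k < rk w l)%N = (p (al k) < p (al l))%N.
Proof.
case: (ltngtP (p (al k)) (p (al l))) => [/rk_mono -> //|/rk_mono h|/pos_inj/al_inj ->].
  by apply/negbTE; rewrite -leqNgt ltnW.
by rewrite ltnn.
Qed.

Lemma rk_inj : injective (rk w).
Proof.
move=> k l E; apply/al_inj/pos_inj.
by case: (ltngtP (p (al k)) (p (al l))) => // /rk_mono; rewrite E ltnn.
Qed.

Lemma card_subs : #|{: 'I_n * bool}| = (2 * n)%N.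
Proof. by rewrite card_prod card_bool card_ord mulnC. Qed.

Lemma rk_surj j : (j < 2 * n)%N -> exists k, rk w k = j.
Proof.
rewrite -card_subs; apply: rank_surj; first exact: rk_inj.
by move=> k; rewrite card_subs rk_lt.
Qed.

(** Conjugation turns [al k] into [be (sopp k)], and beta-letters are ordered like alpha-letters, so
    [sopp] reverses ranks. In particular the n-th and (n+1)-th alpha-letters have opposite
    subscripts. *)
Lemma rk_opp k : (rk w k + rk w (sopp k))%N = (2 * n).-1.
Proof.
rewrite -card_subs; apply: rank_reverse.
- exact: rk_inj.
- by move=> l; rewrite card_subs rk_lt.
- exact: inv_inj soppK.
- move=> l m; rewrite !rk_ltE pos_mono.
  by have := pos_be_opp (sopp l); have := pos_be_opp (sopp m); rewrite !soppK; lia.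
Qed.

End Sketch.
End Words.

(** * Lexicographic comparison of sketches *)

Section Lex.
Context {n : nat}.
Implicit Types (w : word n) (a b : letter n) (k l : 'I_n * bool).

Definition key_lt a b : bool := (letter_key a < letter_key b)%O.

Lemma key_ltE a b : key_lt a b =
  (is_alpha a < is_alpha b)%O || (is_alpha a == is_alpha b) && (subscript a < subscript b).
Proof.
rewrite /key_lt /letter_key Order.ProdLexiOrder.ltEprodlexi /=.
by case: (is_alpha a) (is_alpha b) => [] [].
Qed.

Lemma key_lt_al k l : key_lt (al k) (al l) = (subscript (al k) < subscript (al l)).
Proof. by rewrite key_ltE !is_alpha_al ltxx eqxx. Qed.

Lemma key_lt_be k l : key_lt (be k) (be l) = (subscript (al k) < subscript (al l)).
Proof. by rewrite key_ltE !is_alpha_be ltxx eqxx. Qed.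

Lemma key_lt_be_al k l : key_lt (be k) (al l).
Proof. by rewrite key_ltE is_alpha_al is_alpha_be. Qed.

Lemma key_lt_al_be k l : key_lt (al k) (be l) = false.
Proof. by rewrite key_ltE is_alpha_al is_alpha_be. Qed.

(** Since [letter_key] is injective, the key sequences first differ where the words first differ. *)
Lemma sketch_ltP w w' :
  reflect (exists2 j : 'I_(4 * n), forall k : 'I_(4 * n), (k < j)%N -> tnth w k = tnth w' k
                                 & key_lt (tnth w j) (tnth w' j))
          (sketch_lt w w').
Proof.
have -> : sketch_lt w w' =
  @Order.lt _ ((4 * n).-tuplelexi (bool *l int)%type)
    (map_tuple letter_key w) (map_tuple letter_key w').
  by [].
apply: (iffP ltxi_tuplePlt) => -[j eqj ltj]; exists j.
- by move=> k /eqj; rewrite !tnth_map => /letter_key_inj.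
- by rewrite !tnth_map in ltj.
- by move=> k /eqj E; rewrite !tnth_map E.
- by rewrite !tnth_map.
Qed.

Lemma sketch_lt_total w w' : w <> w' -> sketch_lt w w' \/ sketch_lt w' w.
Proof.
move=> ne; apply/orP; rewrite /sketch_lt -neq_lt.
apply/eqP => /(inj_map letter_key_inj) E; exact/ne/val_inj.
Qed.

Lemma sketch_lt_asym w w' : sketch_lt w w' -> sketch_lt w' w = false.
Proof. by rewrite /sketch_lt => /lt_gtF. Qed.

End Lex.

(** * Sketches satisfying (1)-(4) are maximal *)

Section Equivalence.
Context {n : nat}.
Implicit Types (w : word n) (a b : letter n) (k l : 'I_n * bool).

(** The combinatorial form of ST equivalence; [ST_equivalentP] proves that they agree on symmetric
    sketches. *)
Definition comb_equiv w w' : Prop :=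
  forall a b, relevant a b -> before w a b = before w' a b.

Lemma sub_neq k l : k <> l -> k <> sopp l -> k.1 != l.1.
Proof.
case: k l => i s [j t] /= H1 H2; apply/eqP => E; subst j.
by case: s t H1 H2 => [] [].
Qed.

Lemma relevant_al k l : ~~ k.2 -> l.2 -> k <> sopp l -> relevant (al k) (al l).
Proof.
move=> hk hl kl; rewrite /relevant is_alpha_al /positive /negative /= hk hl /=.
by apply: sub_neq => // E; rewrite E hl in hk.
Qed.

Lemma relevant_be k l : ~~ k.2 -> l.2 -> k <> sopp l -> relevant (al k) (be l).
Proof. by move=> hk hl kl; have := relevant_al hk hl kl; rewrite /relevant /= !is_alpha_al. Qed.

End Equivalence.

Section Sufficiency.
Context {n : nat}.
Variables w w' : word n.
Hypothesis (sw : symmetric_sketch w) (sw' : symmetric_sketch w').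
Hypothesis hw : ST_conditions w.
Hypothesis ew : comb_equiv w w'.
Local Notation p a := (index a w).
Local Notation q a := (index a w').
Local Notation sub k := (subscript (al k)).
Implicit Types (k l b c d e z : 'I_n * bool).

(** This lemma and the next three restate (1)-(4) for [w] as relations between positions. *)
Lemma cond1_pos e c : p (al c) = (p (be e)).+1 -> [/\ e.2, ~~ c.2 & e.1 != c.1].
Proof.
move=> h; have [c1 _ _ _] := hw.
have [||| h1 h2 h3] := c1 (be e) (al c); rewrite /is_beta ?is_alpha_be ?is_alpha_al //.
  by rewrite /followed_by h.
by split=> //; apply/eqP => E; apply: h3; rewrite /mod_value /= E.
Qed.

Lemma cond2_pos c c' : p (al c') = (p (al c)).+1 -> p (be c') = (p (be c)).+1 ->
  c.2 = c'.2 -> sub c' < sub c.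
Proof.
move=> h1 h2 h3; have [_ c2 _ _] := hw.
apply: c2; rewrite ?is_alpha_al //; first by rewrite /followed_by h1.
by rewrite /consecutive /followed_by /corresponding /= -/(be c) -/(be c') h2 eqxx.
Qed.

Lemma cond3_pos d c : (rk w d).+1 = n.-1 -> (rk w c).+1 = n ->
  p (al (sopp c)) = (p (al c)).+1 ->
  [/\ p (al c) = (p (al d)).+1, ~~ c.2
    & d.2 -> p (be c) = (p (be d)).+1 -> sub (sopp c) < sub d].
Proof.
move=> rd rc h; have [_ _ c3 _] := hw; have tw := sketch_total sw.
have := c3 (al d) (al c) (al (sopp c)).
case.
- by apply/(kth_alphaP _ _ tw); rewrite is_alpha_al.
- by apply/(kth_alphaP _ _ tw); rewrite is_alpha_al.
- apply/(kth_alphaP _ _ tw); rewrite is_alpha_al; split=> //=.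
  by have := rk_opp sw c; lia.
- by rewrite /consecutive /followed_by h eqxx.
move=> h1 h2 h3; split=> //.
  have : (p (al d) < p (al c))%N by rewrite -(rk_ltE sw); lia.
  by move: h1; rewrite /consecutive /followed_by => /orP [] /eqP; lia.
move=> h4 h5; apply: (h3 (be d) (be c)) => //.
- by apply/(kth_betaP sw); rewrite /is_beta is_alpha_be.
- by apply/(kth_betaP sw); rewrite /is_beta is_alpha_be.
- by rewrite /consecutive /followed_by h5 eqxx.
Qed.

(** Positions count from 0, so the (2n-1)-th and (2n+1)-th letters stand at 2n - 2 and 2n. *)
Lemma cond4_pos c c' : p (be c) = (2 * n - 2)%N -> p (be c') = (2 * n)%N ->
  (2 <= n)%N -> c.2 -> c'.2 ->
  p (al c') = (p (al c)).+1 -> sub c' < sub c.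
Proof.
move=> h1 h2 n2 h3 h4 h5; have [_ _ _ c4] := hw; have tw := sketch_total sw.
apply: (c4 (be c) (be c')); rewrite /is_beta ?is_alpha_be //.
- by apply/(kth_letterP _ _ tw); lia.
- by apply/(kth_letterP _ _ tw); lia.
- rewrite /consecutive /followed_by /corresponding /= !negbK.
  by rewrite -/(al c) -/(al c') h5 eqxx.
Qed.

(** Take for [be e] the last beta-letter before [al b]: everything after it up to [al b] is alpha,
    and (1) applies to [be e] and its successor. *)
Lemma last_descent a b : is_beta a -> (p a < p (al b))%N ->
  exists e c, [/\ p (al c) = (p (be e)).+1, (p a <= p (be e))%N, (p (al c) <= p (al b))%N
    & forall s, (p (al c) <= p s <= p (al b))%N -> is_alpha s].
Proof.
move=> ba ab; pose P j := (j < p (al b))%N && [exists e, p (be e) == j].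
have exP : exists j, P j.
  exists (p a); rewrite /P ab /=; apply/existsP; exists a.1.
  by rewrite {2}[a]letterP (negbTE ba).
have [j /andP [jb /existsP [e /eqP ej]] jmax] := ex_maxnP exP (fun j => fun H : P j => ltnW (andP H).1).
have nobeta s : (j < p s <= p (al b))%N -> is_alpha s.
  case: (alphaP s) => // l /andP [h1 h2]; have /jmax : P (p (be l)); last by lia.
  apply/andP; split; last by apply/existsP; exists l.
  by rewrite ltn_neqAle h2 andbT; apply/eqP => /esym/(pos_al_be_neq sw).
have hj : (j.+1 < 4 * n)%N by have := pos_lt sw (al b); lia.
have [y yj] := pos_surj sw hj.
have /nobeta : (j < p y <= p (al b))%N by lia.
case: (alphaP y) yj => // c cj _; exists e, c; split.
- lia.
- have : P (p a) by rewrite /P ab; apply/existsP; exists a.1; rewrite {2}[a]letterP (negbTE ba).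
  by move/jmax; lia.
- lia.
- by move=> s hs; apply: nobeta; lia.
Qed.

Hypothesis n2 : (2 <= n)%N.

(** The ranks of [sopp b] and [b] are symmetric about the middle, so the n-th and (n+1)-th
    alpha-letters lie in this block. With no beta-letter in the block they are adjacent, as (3)
    requires. *)
Lemma middle_pair b : (p (al (sopp b)) < p (al b))%N ->
  (forall s, (p (al (sopp b)) <= p s <= p (al b))%N -> is_alpha s) ->
  exists d c, [/\ (rk w d).+1 = n.-1, (rk w c).+1 = n,
    p (al (sopp c)) = (p (al c)).+1,
    (p (al (sopp b)) <= p (al c))%N & (p (al (sopp c)) <= p (al b))%N].
Proof.
move=> ltb allb.
have hc : (n.-1 < 2 * n)%N by lia.
have [c rc] := rk_surj sw hc.
have hd : (n.-2 < 2 * n)%N by lia.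
have [d rd] := rk_surj sw hd.
exists d, c.
have rb := rk_opp sw b; have rco := rk_opp sw c.
have rlt := ltb; rewrite -(rk_ltE sw) in rlt.
have le k l : (rk w k <= rk w l)%N -> (p (al k) <= p (al l))%N.
  by rewrite leqNgt (rk_ltE sw) -leqNgt.
have bc := le (sopp b) c; have cb := le (sopp c) b.
have cc : (p (al c) < p (al (sopp c)))%N by rewrite -(rk_ltE sw); lia.
split; [lia|lia| |apply: bc; lia|apply: cb; lia].
have hcn : ((p (al c)).+1 < 4 * n)%N by have := pos_lt sw (al (sopp c)); lia.
have [s hs] := pos_surj sw hcn.
have {bc cb} [bc cb] : (p (al (sopp b)) <= p (al c) /\ p (al (sopp c)) <= p (al b))%N.
  by split; [apply: bc|apply: cb]; lia.
have /allb : (p (al (sopp b)) <= p s <= p (al b))%N by lia.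
case: (alphaP s) hs => // l hl _.
have rl : (rk w c < rk w l)%N by rewrite (rk_ltE sw); lia.
suff : ~~ (rk w l < rk w (sopp c))%N by rewrite (rk_ltE sw); lia.
by lia.
Qed.

(** Here [i] is the place of the first difference, where [w'] has [al b]. *)
Section FirstDifference.
Variables (i : nat) (b : 'I_n * bool).
Hypothesis qb : q (al b) = i.
(** The words agree before place [i], so the letters from there on are the same in both. *)
Hypothesis suffix : forall s, (i <= p s)%N -> (i <= q s)%N.

Lemma suffix_lt s : (i <= p s)%N -> s <> al b -> (q (al b) < q s)%N.
Proof.
move=> /suffix; rewrite -qb leq_eqVlt => /orP [/eqP /(pos_inj sw') -> //|//].
Qed.

(** Otherwise [al c] and [al b] form a relevant pair up to order, with [al c] first in [w]; but in
    [w'] the letter [al b] precedes all others from place [i] on. *)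
Lemma no_positive_before c : (i <= p (al c))%N -> (p (al c) < p (al b))%N ->
  c.2 != b.2 -> c = sopp b.
Proof.
move=> ic cb sc; apply: contrapT => cnb.
have cb' : c <> b by move=> E; rewrite E ltnn in cb.
have qc := suffix_lt ic (fun E => cb' (al_inj E)).
case hb : (b.2) sc => sc.
  have hc : ~~ c.2 by case: (c.2) sc.
  by have := ew (relevant_al hc hb cnb); rewrite /before cb; lia.
have hc : c.2 by case: (c.2) sc.
have bnc : b <> sopp c by move=> E; apply: cnb; rewrite E soppK.
have := ew (relevant_al (negbT hb) hc bnc); rewrite /before qc; lia.
Qed.

Lemma no_beta_before s : (i <= p s)%N -> (p s < p (al b))%N -> is_alpha s.
Proof.
move=> is_ sb; case: (boolP (is_alpha s)) => // sbeta.
have [e [c [ce se cb allc]]] := last_descent sbeta sb.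
have [he hc ec] := cond1_pos ce.
(* For positive [b], the beta-letter [be e] passes from before [al b] in [w] to after it in [w'],
   which forces [b = sopp e]. *)
have [hb|hb] := boolP b.2; last first.
  have qe : (q (al b) < q (be e))%N by apply: suffix_lt; [lia|move=> /esym/al_be].
  have {}eb : b = sopp e.
    apply: contrapT => eb; have := ew (relevant_be hb he eb).
    by rewrite /before qe; lia.
  have cb' : c <> b by move=> E; rewrite E eb /= eqxx in ec.
  have cltb : (p (al c) < p (al b))%N.
    by rewrite ltn_neqAle cb andbT; apply/eqP; exact: pos_al_neq.
  have h4 : ((p (al b)).-1 < 4 * n)%N by have := pos_lt sw (al b); lia.
  have [t ht] := pos_surj sw h4.
  have /allc ta : (p (al c) <= p t <= p (al b))%N by lia.
  have := pos_conjugate sw t; have := pos_conjugate sw (al b).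
  rewrite conjugate_al eb soppK -eb => E1 E2.
  (* As [be e] is the conjugate of [al b], the letter just before [al b] is conjugate to the letter
     just after [be e]; yet both are alpha-letters. *)
  have /(pos_inj sw) tc : p (conjugate t) = p (al c) by lia.
  by have := is_alpha_conjugate t; rewrite tc is_alpha_al ta.
have cltb : (p (al c) < p (al b))%N.
  by rewrite ltn_neqAle cb andbT; apply/eqP => /(pos_inj sw)/al_inj E; rewrite E hb in hc.
have cb' : c = sopp b.
  by apply: no_positive_before => //; [lia|rewrite hb; case: (c.2) hc].
subst c.
(* Negative [b]: by (3) the n-th alpha-letter is positive, hence it is [al (sopp b)], and an
   alpha-letter precedes it; but its predecessor is [be e]. *)
have [d [m [rd rm mm bm mb]]] := middle_pair cltb allc.
have [dm hm _] := cond3_pos rd rm mm.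
have hmb : m = sopp b.
  apply: no_positive_before; [lia|lia|by rewrite hb; case: (m.2) hm].
subst m; have /(pos_inj sw) /al_be // : p (al d) = p (be e) by lia.
Qed.

Lemma same_sign_before c : (i <= p (al c))%N -> (p (al c) < p (al b))%N ->
  c <> sopp b -> c.2 = b.2.
Proof.
by move=> ic cb cnb; apply: contrapT => /eqP h; exact/cnb/(no_positive_before ic cb).
Qed.

(** The second alternative is the configuration of condition (4). *)
Lemma next_beta c c' : (i <= p (al c))%N -> p (al c') = (p (al c)).+1 ->
  (p (al c') <= p (al b))%N -> c <> sopp b ->
  p (be c') = (p (be c)).+1 \/
  [/\ b.2, c' = b, p (be c) = (2 * n - 2)%N & p (be b) = (2 * n)%N].
Proof.
move=> ic cc' c'b cnb.
have cb : (p (al c) < p (al b))%N by lia.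
have sc := same_sign_before ic cb cnb.
have bcc' : (p (be c) < p (be c'))%N by rewrite -(pos_mono sw); lia.
have bc'b : (p (be c') <= p (be b))%N by rewrite leqNgt -(pos_mono sw) -leqNgt.
(* Beta-letters follow the order of their alpha-letters, so none lies between [be c] and [be c']. *)
have gap y : (p (be c) < p (be y))%N -> (p (be y) < p (be c'))%N -> False.
  by rewrite -!(pos_mono sw); lia.
have hc4 : ((p (be c)).+1 < 4 * n)%N by have := pos_lt sw (be c'); lia.
have [t] := pos_surj sw hc4.
case: (alphaP t) => z hz; last first.
  left; rewrite -hz; apply: contrapT => E; apply: (gap z); lia.
right; have [hc hzs czs] := cond1_pos hz.
have hb : b.2 by rewrite -sc.
have qbc : (q (be b) < q (be c))%N.
  rewrite -(pos_mono sw'); apply: suffix_lt => // /al_inj E.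
  by rewrite E ltnn in cb.
have zc : z <> sopp c by move=> E; rewrite E eqxx in czs.
(* Otherwise [al z] is relevant to both [be c] and [be b] and lies between them in [w], hence also
   in [w'], where [be b] comes before [be c]. *)
have zb : z = sopp b.
  apply: contrapT => zb; have := ew (relevant_be hzs hb zb).
  have := ew (relevant_be hzs hc zc); rewrite /before.
  by have := @pos_al_be_neq _ _ sw' z c; have := @pos_al_be_neq _ _ sw z b; lia.
subst z; have ob := pos_al_opp sw b; have oc' := pos_al_opp sw c'.
have pc := pos_al_be sw c.
(* Otherwise [al (sopp c')] in its turn separates [be c] from [be b] in the same order in both
   words. *)
have c'E : c' = b.
  apply: contrapT => c'nb.
  have c'ltb : (p (al c') < p (al b))%N.
    by rewrite ltn_neqAle c'b andbT; apply/eqP; exact: pos_al_neq.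
  have c'nob : c' <> sopp b by move=> E; rewrite -E in hz; lia.
  have sc' : c'.2 by rewrite (same_sign_before _ c'ltb c'nob) //; lia.
  have r1 : relevant (al (sopp c')) (be c).
    apply: relevant_be => //=; first by rewrite sc'.
    by move=> /(congr1 sopp); rewrite !soppK => E; rewrite E in cc'; lia.
  have r2 : relevant (al (sopp c')) (be b).
    apply: relevant_be => //=; first by rewrite sc'.
    by move=> /(congr1 sopp); rewrite !soppK.
  have bne := pos_be_neq sw c'nb.
  have := ew r1; have := ew r2; rewrite /before.
  by have := @pos_al_be_neq _ _ sw' (sopp c') c; have := @pos_al_be_neq _ _ sw (sopp b) c'; lia.
subst c'.
(* Then [al (sopp b)] and [be b], whose positions add up to 4n - 1, stand at 2n - 1 and 2n. A letter
   strictly between them, or its conjugate, would be a beta-letter forbidden by [gap]. *)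
suff : p (be b) = (p (al (sopp b))).+1 by split=> //; lia.
apply: contrapT => Ene.
have hs4 : ((p (al (sopp b))).+1 < 4 * n)%N by have := pos_lt sw (be b); lia.
have [s hs] := pos_surj sw hs4.
have nab := @pos_al_be_neq _ _ sw (sopp b) b.
have := pos_conjugate sw s.
case: (alphaP s) hs => y hs; last by move=> _; apply: (gap y); lia.
by rewrite conjugate_al => hy; apply: (gap (sopp y)); lia.
Qed.

Lemma alphas_upto c : (i <= p (al c))%N ->
  forall t, (p (al c) <= p t <= p (al b))%N -> is_alpha t.
Proof.
move=> ic t /andP [t1]; rewrite leq_eqVlt => /orP [/eqP/(pos_inj sw) ->|].
  exact: is_alpha_al.
by apply: no_beta_before; lia.
Qed.

(** The middle pair in the block is positive then negative by (3). Its negative member has the sign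
    opposite to [b], so it is [al (sopp b)]; this would put [al b] before [al (sopp b)]. *)
Lemma no_sopp_before : ~~ b.2 -> (i <= p (al (sopp b)))%N ->
  (p (al (sopp b)) < p (al b))%N -> False.
Proof.
move=> hb ib bb.
have [d [k [rd rm mm bm mb]]] := middle_pair bb (alphas_upto ib).
have [dm hm _] := cond3_pos rd rm mm.
have skb : sopp k <> b by move=> E; move: hb; rewrite -E /= hm.
have : sopp k = sopp b.
  apply: no_positive_before; first lia.
    by rewrite ltn_neqAle mb andbT; apply/eqP; exact: pos_al_neq.
  by rewrite /= hm eq_sym; case: (b.2) hb.
by move=> /(congr1 sopp); rewrite !soppK => E; subst k; lia.
Qed.

(** Induction on the distance to [al b]: subscripts decrease from one alpha-letter to the next by
    (2), or by (4) at the last step. Only [sopp b] may break the chain, and (3) steps over it. *)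
Lemma sub_before c : (i <= p (al c))%N -> (p (al c) < p (al b))%N ->
  c <> sopp b -> sub b < sub c.
Proof.
have [m] := ubnP (p (al b) - p (al c))%N; elim: m c => // m IH c lem ic cb cnb.
have sc := same_sign_before ic cb cnb.
have h4 : ((p (al c)).+1 < 4 * n)%N by have := pos_lt sw (al b); lia.
have [s hs] := pos_surj sw h4.
have : is_alpha s.
  have [|sb] := ltnP (p s) (p (al b)); first by apply: no_beta_before; lia.
  have /(pos_inj sw) -> : p s = p (al b) by lia.
  exact: is_alpha_al.
case: (alphaP s) hs => // c' hc' _.
have c'b : (p (al c') <= p (al b))%N by lia.
have [bcc'|[hb E h1 h2]] := next_beta ic hc' c'b cnb; last first.
  by subst c'; apply: (cond4_pos h1 h2) => //; rewrite sc.
have [E|c'nb] := pselect (c' = b); first by subst c'; exact: cond2_pos.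
have c'ltb : (p (al c') < p (al b))%N.
  by rewrite ltn_neqAle c'b andbT; apply/eqP; exact: pos_al_neq.
have ic' : (i <= p (al c'))%N by lia.
have [E|c'nob] := pselect (c' = sopp b); last first.
  apply: (lt_trans (IH c' _ ic' c'ltb c'nob)); first by lia.
  by apply: cond2_pos => //; rewrite sc (same_sign_before ic' c'ltb c'nob).
subst c'.
(* Here [al (sopp b)] is the n-th alpha-letter and [al c] the (n-1)-th; the last part of (3)
   compares [c] with [b] directly. *)
have allb := alphas_upto ic'.
have [d [k [rd rm mm bm mb]]] := middle_pair c'ltb allb.
have [dm hm h3] := cond3_pos rd rm mm.
case: (boolP b.2) => [hb|hb]; last by case: (no_sopp_before hb ic' c'ltb).
have E : k = sopp b by apply: no_positive_before; [lia|lia|rewrite hb; case: (k.2) hm].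
subst k; have /(pos_inj sw)/al_inj E : p (al d) = p (al c) by lia.
by subst d; rewrite soppK in h3; apply: h3 => //; rewrite sc.
Qed.

End FirstDifference.

Lemma not_sketch_lt : ~~ sketch_lt w w'.
Proof.
apply/negP => /sketch_ltP [j same].
have pt (o : 'I_(4 * n)) : p (tnth w o) = o.
  rewrite (tnth_nth (tnth w o)) index_uniq ?size_tuple //.
  exact/total_order_uniq/sketch_total.
have qt (o : 'I_(4 * n)) : q (tnth w' o) = o.
  rewrite (tnth_nth (tnth w' o)) index_uniq ?size_tuple //.
  exact/total_order_uniq/sketch_total.
have qp s : (p s < j)%N -> q s = p s.
  move=> h; pose o := Ordinal (pos_lt sw s).
  have E : tnth w o = s.
    by rewrite (tnth_nth s) /= nth_index //; exact/total_order_mem/sketch_total.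
  by rewrite -{1}E same // qt.
have pq s : (q s < j)%N -> p s = q s.
  move=> h; pose o := Ordinal (pos_lt sw' s).
  have E : tnth w' o = s.
    by rewrite (tnth_nth s) /= nth_index //; exact/total_order_mem/sketch_total.
  by rewrite -{1}E -same // pt.
have suffix s : (j <= p s)%N -> (j <= q s)%N.
  by move=> h; rewrite leqNgt; apply/negP => h'; move: h; rewrite (pq _ h') leqNgt h'.
have := pt j; have := qt j.
move: (tnth w j) (tnth w' j) => x x' qx' px.
case: (alphaP x') qx' => b qb.
  have [->|xb] := pselect (x = al b); first by rewrite key_lt_al ltxx.
  have jb : (p x < p (al b))%N.
    rewrite ltnNge leq_eqVlt; apply/negP => /orP [/eqP/(pos_inj sw) E|]; first exact: xb.
    by rewrite px => /[dup] /qp; lia.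
  have jb0 : (j <= p x)%N by rewrite px.
  have xa : is_alpha x by apply: (no_beta_before qb suffix jb0 jb).
  case: (alphaP x) xa px xb jb => // a _ pa ab jb; rewrite key_lt_al => lt_ab.
  have [E|anb] := pselect (a = sopp b); last first.
    by have := sub_before qb suffix _ jb anb; rewrite pa leqnn => /(_ isT); lia.
  subst a; apply: (no_sopp_before qb suffix _ _ jb); last by rewrite pa.
  by move: lt_ab; rewrite subscript_sopp; case: (b) => k [] //; rewrite /subscript /negative /mod_value /=; lia.
(* A first difference between two beta-letters is impossible: their alpha-letters come earlier,
   where the words agree, and fix the order of the beta-letters. *)
case: (alphaP x) px => a pa; rewrite ?key_lt_al_be // key_lt_be => lt_ab.
have ab : a <> b by move=> E; rewrite E ltxx in lt_ab.
have pba := pos_be_neq sw ab; have qba := pos_be_neq sw' ab.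
have qab : (q (al b) < q (al a))%N.
  by rewrite (pos_mono sw'); have := suffix (be a); rewrite pa leqnn => /(_ isT); lia.
have pab : (p (al a) < p (al b))%N.
  by rewrite (pos_mono sw); have := qp (be b); case: (ltnP (p (be b)) j) => [h /(_ isT)|]; lia.
have /qp : (p (al a) < j)%N by rewrite -pa pos_al_be.
have /pq : (q (al b) < j)%N by rewrite -qb pos_al_be.
lia.
Qed.

End Sufficiency.

(** * Maximal sketches satisfy (1)-(4) *)

Section DoubleSwap.
Context {T : eqType} (f : T -> T).
Hypothesis (fK : involutive f) (f_neq : forall x, f x <> x).

(** The exchange of [u] and [v] together with that of [f u] and [f v], so that it commutes with [f];
    for [v = f u] it is a single transposition. *)
Definition dswap (u v x : T) : T :=
  if x == u then v else if x == v then u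
  else if x == f u then f v else if x == f v then f u else x.

Lemma dswapK u v : involutive (dswap u v).
Proof.
move=> x; have := (fK u, fK v, fK x); have := (@f_neq u, @f_neq v, @f_neq x).
move=> [[? ?] ?] [[? ?] ?]; rewrite [X in dswap u v X]/dswap.
by do ![case: eqP => ?]; rewrite /dswap; do ![case: eqP => ?]; congruence.
Qed.

Lemma dswap_comm u v x : dswap u v (f x) = f (dswap u v x).
Proof.
have := (fK u, fK v, fK x); have := (@f_neq u, @f_neq v, @f_neq x).
move=> [[? ?] ?] [[? ?] ?]; rewrite /dswap.
by do ![case: eqP => ?]; congruence.
Qed.

End DoubleSwap.

(** * Exchanging subscripts, and exchanging adjacent letters *)

Section MapWord.
Context {n : nat}.
Implicit Types (w : word n) (x y u v : letter n) (k l a b c d e z : 'I_n * bool).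

Section Involution.
Variable f : letter n -> letter n.
Hypothesis fK : involutive f.

Definition map_word w : word n := map_tuple f w.

Lemma index_map_word w x : index x (map_word w) = index (f x) w.
Proof. by rewrite -{1}[x]fK /= index_map //; exact: inv_inj. Qed.

Lemma before_map_word w x y : before (map_word w) x y = before w (f x) (f y).
Proof. by rewrite /before !index_map_word. Qed.

Lemma total_map_word w : total_order_word w -> total_order_word (map_word w).
Proof.
move=> tw x; rewrite /= count_map; apply: etrans (tw (f x)); apply: eq_count => y /=.
by rewrite (can2_eq fK fK).
Qed.

Lemma sketch_lt_map_word w x : total_order_word w ->
  (forall y, before w y x -> f y = y) -> key_lt x (f x) -> sketch_lt w (map_word w).
Proof.
move=> tw fx ltx; have xw := index_lt tw x; rewrite card_letter in xw.
apply/sketch_ltP; exists (Ordinal xw); last first.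
  by rewrite tnth_map (tnth_nth x) /= nth_index //; exact: total_order_mem.
move=> k /= kx; rewrite tnth_map fx // /before (tnth_nth x).
by rewrite index_uniq ?size_tuple //; exact: total_order_uniq.
Qed.

End Involution.

Definition relabel a b x : letter n :=
  if is_alpha x then al (dswap sopp a b x.1) else be (dswap sopp a b x.1).

Lemma relabel_al a b k : relabel a b (al k) = al (dswap sopp a b k).
Proof. by rewrite /relabel is_alpha_al. Qed.

Lemma relabel_be a b k : relabel a b (be k) = be (dswap sopp a b k).
Proof. by rewrite /relabel is_alpha_be. Qed.

Lemma relabelK a b : involutive (relabel a b).
Proof.
by move=> x; case: (alphaP x) => k; rewrite ?(relabel_al, relabel_be) dswapK //;
  [exact: soppK|exact: sopp_neq|exact: soppK|exact: sopp_neq].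
Qed.

Lemma relabel_conjugate a b x : relabel a b (conjugate x) = conjugate (relabel a b x).
Proof.
by case: (alphaP x) => k;
  rewrite ?(conjugate_al, conjugate_be, relabel_al, relabel_be) dswap_comm //;
  [exact: soppK|exact: sopp_neq|exact: soppK|exact: sopp_neq].
Qed.

(** Relabelling commutes with conjugation and keeps alpha- and beta-letters apart, so every axiom is
    transported, whatever [a] and [b] are. *)
Lemma relabel_sketch a b w :
  symmetric_sketch w -> symmetric_sketch (map_word (relabel a b) w).
Proof.
have fK := relabelK a b.
move=> /sketchE [tw cw mw sw]; apply/sketchE; split.
- exact: total_map_word.
- by move=> x y; rewrite !before_map_word // !relabel_conjugate; exact: cw.
- by move=> k l; rewrite !before_map_word // !relabel_al !relabel_be; exact: mw.
- by move=> k; rewrite before_map_word // relabel_al relabel_be; exact: sw.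
Qed.

Lemma relabel_fix a b x :
  x.1 <> a -> x.1 <> b -> x.1 <> sopp a -> x.1 <> sopp b -> relabel a b x = x.
Proof.
move=> h1 h2 h3 h4; rewrite [in RHS](letterP x) /relabel /dswap.
by rewrite (introF eqP h1) (introF eqP h2) (introF eqP h3) (introF eqP h4).
Qed.

Lemma conjugate_neq x : conjugate x <> x.
Proof. by case: x => [[i []] s]. Qed.

Section Swap.
Variables (w : word n) (e z : 'I_n * bool).
Hypothesis sw : symmetric_sketch w.
Local Notation p x := (index x w).
Hypothesis ez : p (al z) = (p (be e)).+1.

Definition swap_letters : letter n -> letter n := dswap conjugate (be e) (al z).
Local Notation f := swap_letters.

Lemma swap_lettersK : involutive f.
Proof. by apply: dswapK; [exact: conjugateK|exact: conjugate_neq]. Qed.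

Lemma index_swap_letters x : p (f x) =
  if p x == p (be e) then p (al z) else if p x == p (al z) then p (be e)
  else if p x == p (al (sopp e)) then p (be (sopp z))
  else if p x == p (be (sopp z)) then p (al (sopp e)) else p x.
Proof.
rewrite !(inj_eq (pos_inj sw)) /swap_letters /dswap conjugate_al conjugate_be.
by do ![case: eqP => _].
Qed.

(** The exchanged letters [be e], [al z] are adjacent, and so are their conjugates; hence only these
    two pairs change their order. *)
Lemma swap_before x y :
  ~ (x = be e /\ y = al z) -> ~ (x = al z /\ y = be e) ->
  ~ (x = be (sopp z) /\ y = al (sopp e)) -> ~ (x = al (sopp e) /\ y = be (sopp z)) ->
  (p (f x) < p (f y))%N = (p x < p y)%N.
Proof.
have h1 := pos_conjugate sw (be e); have h2 := pos_conjugate sw (al z).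
rewrite conjugate_al conjugate_be in h1 h2.
have lift u v (E : p u = p v) : u = v by exact: (pos_inj sw).
move=> H1 H2 H3 H4; rewrite !index_swap_letters.
have {}H1 : ~ (p x = p (be e) /\ p y = p (al z)) by move=> [/lift ? /lift ?]; exact: H1.
have {}H2 : ~ (p x = p (al z) /\ p y = p (be e)) by move=> [/lift ? /lift ?]; exact: H2.
have {}H3 : ~ (p x = p (be (sopp z)) /\ p y = p (al (sopp e))).
  by move=> [/lift ? /lift ?]; exact: H3.
have {}H4 : ~ (p x = p (al (sopp e)) /\ p y = p (be (sopp z))).
  by move=> [/lift ? /lift ?]; exact: H4.
(* The positions of [be e] and [be (sopp z)] add up to 4n - 2, so they do not differ by 1: the two
   adjacent pairs coincide or are disjoint. *)
have {h1 h2} [h1 [h2 h3]] : p (al (sopp e)) = (p (be (sopp z))).+1 /\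
  p (be e) <> (p (be (sopp z))).+1 /\ (p (be e)).+1 <> p (be (sopp z)) by lia.
move: (p x) (p y) (p (al z)) (p (be e)) (p (al (sopp e))) (p (be (sopp z))) ez h1 h2 h3 H1 H2 H3 H4.
move=> a b ? e' ? d -> -> h h' H1 H2 H3 H4.
by do ![case: eqP => ?]; lia.
Qed.

Hypothesis irr : ~~ relevant (al z) (be e).

Lemma swap_neq : e <> z.
Proof. by move=> E; have := pos_al_be sw z; rewrite ez E; lia. Qed.

Lemma swap_sketch : symmetric_sketch (map_word f w).
Proof.
have fK := swap_lettersK; have ne := swap_neq.
have fc x : f (conjugate x) = conjugate (f x).
  by apply: dswap_comm; [exact: conjugateK|exact: conjugate_neq].
apply/sketchE; split.
- by apply: total_map_word => //; exact: sketch_total.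
- move=> x y; rewrite !(before_map_word fK) /before !fc.
  by have := pos_conjugate sw (f x); have := pos_conjugate sw (f y); lia.
- move=> k l; rewrite !(before_map_word fK) /before.
  rewrite [X in is_true X -> _]swap_before.
  + rewrite [X in _ -> is_true X]swap_before.
    * by rewrite (pos_mono sw).
    * by case=> _ /esym/al_be.
    * by case=> /esym/al_be.
    * by case=> _ /esym/al_be.
    * by case=> /esym/al_be.
  + by case=> /al_be.
  + by case=> _ /al_be.
  + by case=> /al_be.
  + by case=> _ /al_be.
- move=> k; rewrite (before_map_word fK) /before swap_before; first exact: (pos_al_be sw).
  - by case=> /al_be.
  - by case=> /al_inj -> /be_inj /esym.
  - by case=> /al_be.
  - by case=> /al_inj -> /be_inj /(congr1 sopp); rewrite !soppK.
Qed.

(** The two pairs that change order are conjugate, so both are irrelevant as soon as one is. *)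
Lemma swap_comb_equiv : comb_equiv w (map_word f w).
Proof.
have fK := swap_lettersK.
move=> x y xy; rewrite (before_map_word fK) /before swap_before; first by [].
- by case=> E _; move: xy; rewrite E /relevant is_alpha_be.
- by case=> Ex Ey; move: xy irr; rewrite Ex Ey => ->.
- by case=> E _; move: xy; rewrite E /relevant is_alpha_be.
- case=> Ex Ey; move: xy irr; rewrite Ex Ey /relevant !is_alpha_al /positive /negative /=.
  by rewrite negbK => /and3P [-> -> h]; rewrite eq_sym h.
Qed.

End Swap.
End MapWord.

(** * Relabellings that preserve equivalence *)

Section Relabel.
Context {n : nat}.
Variables (w : word n) (a b : 'I_n * bool).
Implicit Types (x y : letter n) (k l : 'I_n * bool).
Hypothesis sw : symmetric_sketch w.
Local Notation p x := (index x w).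
Hypothesis ab : p (al b) = (p (al a)).+1.
Local Notation t := (dswap sopp a b).

Let neqs k c := (p (al k) <> p (al c) /\ p (al k) <> p (be c)) /\
                (p (be k) <> p (be c) /\ p (be k) <> p (al c)).

Let neqsP k c : k <> c -> neqs k c.
Proof.
move=> kc; split; split.
- exact: pos_al_neq.
- exact: pos_al_be_neq.
- exact: pos_be_neq.
- by move=> /esym; exact: pos_al_be_neq.
Qed.

Lemma dswap_same_sign k : a.2 = b.2 -> k.2 = a.2 ->
  t k = if k == a then b else if k == b then a else k.
Proof.
move=> hab hk; rewrite /dswap; do 2 case: ifP => // _.
rewrite !ifN //; apply/eqP => E; move: hk; rewrite E /= -?hab.
  by case: (a.2).
by case: (b.2) hab => ->.
Qed.

Lemma dswap_opp_sign k : a.2 = b.2 -> k.2 = ~~ a.2 ->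
  t k = if k == sopp a then sopp b else if k == sopp b then sopp a else k.
Proof.
move=> hab hk; rewrite /dswap ifN; last first.
  by apply/eqP => E; move: hk; rewrite E; case: (a.2).
by rewrite ifN //; apply/eqP => E; move: hk; rewrite E hab; case: (b.2).
Qed.

(** The second form of the last hypothesis, the configuration of condition (4),
    lets one irrelevant letter stand between the two beta-letters. *)
Lemma relabel_order_same k l : a.2 = b.2 -> ~~ k.2 -> l.2 -> k <> sopp l ->
  p (be b) = (p (be a)).+1 \/
  [/\ a.2, b.2, p (al (sopp b)) = (p (be a)).+1 & p (be b) = (p (be a)).+2] ->
  (p (al k) < p (al l))%N = (p (al (t k)) < p (al (t l)))%N /\
  (p (al k) < p (be l))%N = (p (al (t k)) < p (be (t l)))%N.
Proof.
move=> hab hk hl kl hb.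
have E1 := pos_al_opp sw a; have E2 := pos_al_opp sw b.
have E3 := pos_be_opp sw a; have E4 := pos_be_opp sw b.
have F1 := pos_al_be sw a; have F2 := pos_al_be sw b.
have G c d := @pos_al_be_neq _ _ sw c d.
case ha : a.2.
  have := (G (sopp a) b, G (sopp b) a, G k a, G k b, G (sopp a) l, G (sopp b) l, G l a, G l b).
  clear G; move=> [[[[[[[G1 G2] G3] G4] G5] G6] G7] G8].
  rewrite dswap_opp_sign; [|exact: hab|by rewrite ha; exact/negbTE].
  rewrite (dswap_same_sign (k := l)); [|exact: hab|by rewrite ha hl].
  have [/(pos_al_neq sw) K1 /(pos_al_neq sw) K2] : k <> a /\ k <> b.
    by split=> E; move: hk; rewrite E /= -?hab ha.
  have [/(pos_al_neq sw) L1 /(pos_al_neq sw) L2] : l <> sopp a /\ l <> sopp b.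
    by split=> E; move: hl; rewrite E /= -?hab ha.
  (* By signs [k] can only meet [sopp a], [sopp b] and [l] can only meet [a], [b]; the cases with
     [k = sopp l] are discarded. *)
  case: (k =P sopp a) kl => [-> kl|/neqsP [[k1 k2] [k3 k4]]];
    [|case: (k =P sopp b) => [-> kl|/neqsP [[k5 k6] [k7 k8]] kl]];
  (case: (l =P a) kl => [-> kl|/neqsP [[l1 l2] [l3 l4]]];
    [|case: (l =P b) => [-> kl|/neqsP [[l5 l6] [l7 l8]] kl]]);
  try by case: kl; rewrite ?soppK.
  - by split; clear -ab E1 E2 E3 E4 F1 F2 hb G1 G2; case: hb => [hb|[h1 h2 hb1 hb2]]; lia.
  - split; [clear -ab E1 E2 E3 E4 F1 F2 hb L1 L2 G7 G8|clear -ab E1 E2 E3 E4 F1 F2 hb G5 G6 l3 l7]; case: hb => [hb|[h1 h2 hb1 hb2]]; lia.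
  - by split; clear -ab E1 E2 E3 E4 F1 F2 hb G1 G2; case: hb => [hb|[h1 h2 hb1 hb2]]; lia.
  - split; [clear -ab E1 E2 E3 E4 F1 F2 hb L1 L2 G7 G8|clear -ab E1 E2 E3 E4 F1 F2 hb G5 G6 l3 l7]; case: hb => [hb|[h1 h2 hb1 hb2]]; lia.
  - split; [clear -ab E1 E2 E3 E4 F1 F2 hb K1 K2|clear -ab E1 E2 E3 E4 F1 F2 hb G3 G4 k1 k5]; case: hb => [hb|[h1 h2 hb1 hb2]]; lia.
  - split; [clear -ab E1 E2 E3 E4 F1 F2 hb K1 K2|clear -ab E1 E2 E3 E4 F1 F2 hb G3 G4 k1 k5]; case: hb => [hb|[h1 h2 hb1 hb2]]; lia.
  - by [].
have := (G a (sopp b), G b (sopp a), G k (sopp a), G k (sopp b), G a l, G b l).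
clear G; move=> [[[[[G1 G2] G3] G4] G5] G6].
rewrite (dswap_same_sign (k := k)); [|exact: hab|by rewrite ha; exact/negbTE].
rewrite (dswap_opp_sign (k := l)); [|exact: hab|by rewrite ha hl].
have {}hb : p (be b) = (p (be a)).+1 by case: hb => // -[]; rewrite ha.
have [/(pos_al_neq sw) K1 /(pos_al_neq sw) K2] : k <> sopp a /\ k <> sopp b.
  by split=> E; move: hk; rewrite E /= -?hab ha.
have [/(pos_al_neq sw) L1 /(pos_al_neq sw) L2] : l <> a /\ l <> b.
  by split=> E; move: hl; rewrite E /= -?hab ha.
case: (k =P a) kl => [-> kl|/neqsP [[k1 k2] [k3 k4]]];
  [|case: (k =P b) => [-> kl|/neqsP [[k5 k6] [k7 k8]] kl]];
(case: (l =P sopp a) kl => [-> kl|/neqsP [[l1 l2] [l3 l4]]];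
  [|case: (l =P sopp b) => [-> kl|/neqsP [[l5 l6] [l7 l8]] kl]]);
try by case: kl; rewrite ?soppK.
- by split; clear -ab E1 E2 E3 E4 F1 F2 hb G1 G2; lia.
- split; [clear -ab E1 E2 E3 E4 F1 F2 hb L1 L2|clear -ab E1 E2 E3 E4 F1 F2 hb G5 G6]; lia.
- by split; clear -ab E1 E2 E3 E4 F1 F2 hb G1 G2; lia.
- split; [clear -ab E1 E2 E3 E4 F1 F2 hb L1 L2|clear -ab E1 E2 E3 E4 F1 F2 hb G5 G6]; lia.
- split; [clear -ab E1 E2 E3 E4 F1 F2 hb K1 K2|clear -ab E1 E2 E3 E4 F1 F2 hb G3 G4]; lia.
- split; [clear -ab E1 E2 E3 E4 F1 F2 hb K1 K2|clear -ab E1 E2 E3 E4 F1 F2 hb G3 G4]; lia.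
- by [].
Qed.

(** The exchanged places are adjacent, and a relevant pair never involves both [a] and [sopp a], so
    its order survives. *)
Lemma relabel_order_opp k l : b = sopp a -> ~~ k.2 -> l.2 -> k <> sopp l ->
  p (be b) = (p (be a)).+1 ->
  (p (al k) < p (al l))%N = (p (al (t k)) < p (al (t l)))%N /\
  (p (al k) < p (be l))%N = (p (al (t k)) < p (be (t l)))%N.
Proof.
move=> hab hk hl kl hb; have kl' : k <> l by move=> E; rewrite E hl in hk.
have tE c : t c = if c == a then b else if c == b then a else c.
  rewrite /dswap hab soppK; case: eqP => [//|ca]; case: eqP => // cb.
have G c d := @pos_al_be_neq _ _ sw c d.
have := (G k a, G k b, G a l, G b l); clear G; move=> [[[G1 G2] G3] G4].
rewrite !tE.
case: (k =P a) (kl) (kl') => [-> h h'|/(pos_al_neq sw) k1 _ _];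
  [|case: (k =P b) (kl) (kl') => [-> h h'|/(pos_al_neq sw) k2 _ _]].
- have lb : l <> b by move=> E; apply: h; rewrite E hab soppK.
  rewrite (introF eqP (nesym h')) (introF eqP lb).
  have := pos_al_neq sw (nesym h'); have := pos_al_neq sw lb.
  by clear -ab hb G3 G4 => ? ?; lia.
- have la : l <> a by move=> E; apply: h; rewrite E.
  rewrite (introF eqP la) (introF eqP (nesym h')).
  have := pos_al_neq sw (nesym h'); have := pos_al_neq sw la.
  by clear -ab hb G3 G4 => ? ?; lia.
- case: (l =P a) => [->|_]; [|case: (l =P b) => [->|_]; last by []].
  + by split; [clear -ab k1 k2|clear -hb G1 G2]; lia.
  + by split; [clear -ab k1 k2|clear -hb G1 G2]; lia.
Qed.

Lemma relabel_comb_equiv : a.2 = b.2 \/ b = sopp a ->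
  p (be b) = (p (be a)).+1 \/
  [/\ a.2, b.2, p (al (sopp b)) = (p (be a)).+1 & p (be b) = (p (be a)).+2] ->
  comb_equiv w (map_word (relabel a b) w).
Proof.
move=> hs hb x y; rewrite /relevant => /and4P [xa xp yn xy].
rewrite (before_map_word (relabelK a b)).
case: (alphaP x) xa xp xy => // k _; rewrite /positive /negative /= => hk kl.
have kl' : k <> sopp y.1 by move=> E; rewrite E eqxx in kl.
have order : (p (al k) < p (al y.1))%N = (p (al (t k)) < p (al (t y.1)))%N /\
  (p (al k) < p (be y.1))%N = (p (al (t k)) < p (be (t y.1)))%N.
  case: hs => hs; first exact: relabel_order_same.
  apply: relabel_order_opp => //; case: hb => // -[ha hb']; move: ha hb'; rewrite hs /=.
  by case: (a.2).
rewrite relabel_al /before; move: order => [].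
by case: (alphaP y) => l; rewrite ?relabel_al ?relabel_be.
Qed.

End Relabel.

(** * Conditions (1)-(4) from maximality *)

Section Necessity.
Context {n : nat}.
Variable w : word n.
Hypothesis sw : symmetric_sketch w.
Hypothesis max_w : forall w' : word n,
  symmetric_sketch w' -> comb_equiv w w' -> ~~ sketch_lt w w'.
Local Notation p x := (index x w).
Local Notation sub k := (subscript (al k)).
Implicit Types (x y : letter n) (k l a b c d e z : 'I_n * bool).

Lemma comb_equiv_trans (w1 w2 w3 : word n) :
  comb_equiv w1 w2 -> comb_equiv w2 w3 -> comb_equiv w1 w3.
Proof. by move=> h12 h23 x y xy; rewrite h12 // h23. Qed.

Lemma max_no_swap e z : p (al z) = (p (be e)).+1 -> relevant (al z) (be e).
Proof.
move=> ez; apply/negP => /negP irr.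
have fK := swap_lettersK e z; have tw := sketch_total sw.
have := max_w (swap_sketch sw ez irr) (swap_comb_equiv sw ez irr).
move=> /negP; apply.
have h1 := pos_conjugate sw (be e); have h2 := pos_conjugate sw (al z).
have fix_ x : (p x < p (be e))%N -> (p x < p (conjugate (al z)))%N ->
    swap_letters e z x = x.
  move=> xe xz; rewrite /swap_letters /dswap.
  by do 4!(rewrite ifN; last by apply/eqP => E; move: xe xz; rewrite E; lia).
(* The first changed place is that of [be e] or of [be (sopp z)]; either way a beta-letter gives way
   to an alpha-letter. *)
have [le|lt] := leqP (p (be e)) (p (conjugate (al z))).
  apply: (sketch_lt_map_word (x := be e)) => //.
    by move=> y ye; apply: fix_ => //; exact: leq_trans ye le.
  by rewrite /swap_letters /dswap eqxx key_lt_be_al.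
apply: (sketch_lt_map_word (x := conjugate (al z))) => //.
  by move=> y yz; apply: fix_ => //; exact: ltn_trans yz lt.
rewrite /swap_letters dswap_comm; [|exact: conjugateK|exact: conjugate_neq].
rewrite /dswap eqxx ifN ?conjugate_al ?conjugate_be ?key_lt_be_al //.
by apply/eqP => /al_be.
Qed.

Lemma max_cond1 e z : p (al z) = (p (be e)).+1 -> [/\ e.2, ~~ z.2 & e.1 != z.1].
Proof.
move=> /max_no_swap /and4P [_]; rewrite /positive /negative /= => ? ?.
by rewrite eq_sym.
Qed.

Lemma max_no_relabel a b : p (al b) = (p (al a)).+1 -> a.2 = b.2 \/ b = sopp a ->
  p (be b) = (p (be a)).+1 \/
  [/\ a.2, b.2, p (al (sopp b)) = (p (be a)).+1 & p (be b) = (p (be a)).+2] ->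
  sub b < sub a.
Proof.
move=> ab hs hb; rewrite ltNge; apply/negP => le_ab.
have nab : a <> b by move=> E; move: ab; rewrite E; lia.
have {le_ab}lt_ab : sub a < sub b.
  by rewrite lt_neqAle le_ab andbT; apply/eqP => /subscript_inj.
have fK := relabelK a b; have tw := sketch_total sw.
have := max_w (relabel_sketch a b sw) (relabel_comb_equiv sw ab hs hb).
move=> /negP; apply.
have E1 := pos_al_opp sw a; have E2 := pos_al_opp sw b.
have F1 := pos_al_be sw a; have F2 := pos_al_be sw b.
have F3 := pos_al_be sw (sopp a); have F4 := pos_al_be sw (sopp b).
have obE : (p (al (sopp b)) < p (al (sopp a)))%N by case: hb => [|[]]; lia.
have fix_ x : (p x < p (al a))%N -> (p x < p (al (sopp b)))%N -> relabel a b x = x.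
  move=> xa xb; apply: relabel_fix => E; move: xa xb; rewrite (letterP x) E;
  by case: ifP; lia.
(* The first changed place is that of [al a], where [b] replaces [a], or of [al (sopp b)], where
   [sopp a] replaces [sopp b]; both raise the subscript. *)
have [le|lt] := leqP (p (al a)) (p (al (sopp b))).
  apply: (sketch_lt_map_word (x := al a)) => //.
    by move=> y ya; apply: fix_ => //; exact: leq_trans ya le.
  by rewrite relabel_al /dswap eqxx key_lt_al.
apply: (sketch_lt_map_word (x := al (sopp b))) => //.
  by move=> y yb; apply: fix_ => //; exact: ltn_trans yb lt.
rewrite relabel_al dswap_comm; [|exact: soppK|exact: sopp_neq].
rewrite /dswap eqxx ifN; last exact/eqP/nesym.
by rewrite key_lt_al !subscript_sopp ltrN2.
Qed.

Lemma corresponding_al k : corresponding (al k) = be k. Proof. by []. Qed.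

Lemma corresponding_be k : corresponding (be k) = al k.
Proof. by rewrite /corresponding /= negbK. Qed.

Lemma map_word_comp (f g : letter n -> letter n) :
  map_word f (map_word g w) = map_word (f \o g) w.
Proof. by apply: val_inj; rewrite /= map_comp. Qed.

Lemma index_relabel_fix a b x : x.1 <> a -> x.1 <> b -> x.1 <> sopp a -> x.1 <> sopp b ->
  index x (map_word (relabel a b) w) = p x.
Proof. by move=> h1 h2 h3 h4; rewrite (index_map_word (relabelK a b)) relabel_fix. Qed.

Lemma max_condition1 : condition1 w.
Proof.
move=> b a; rewrite /is_beta /followed_by.
case: (alphaP b) => // e _; case: (alphaP a) => // z _ /eqP /max_cond1 [h1 h2 h3].
by split=> // -[] /val_inj E; rewrite E eqxx in h3.
Qed.

Lemma max_condition2 : condition2 w.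
Proof.
move=> x y; case: (alphaP x) => // a _; case: (alphaP y) => // b _.
rewrite /followed_by !corresponding_al => /eqP ab.
have /[swap] /orP [/eqP bab _|/eqP bba] : (p (be a) < p (be b))%N.
  by rewrite -(pos_mono sw); lia.
  by rewrite /negative /= => hs; apply: max_no_relabel => //; [left|left].
by rewrite bba; lia.
Qed.

Lemma max_condition4 : condition4 w.
Proof.
have tw := sketch_total sw.
move=> x y /(kth_letterP _ _ tw) px /(kth_letterP _ _ tw) py.
rewrite /is_beta; case: (alphaP x) px => // a px _ ha.
case: (alphaP y) py => // b py _ hb; rewrite !corresponding_be.
have ab : (p (al a) < p (al b))%N by rewrite (pos_mono sw); lia.
move=> /orP [/eqP h|/eqP h]; last by lia.
apply: max_no_relabel => //; first by left; rewrite [LHS]ha [RHS]hb.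
(* As [be b] stands at 2n, its conjugate [al (sopp b)] stands at 2n - 1, right between the two
   beta-letters. *)
by right; split=> //; have := pos_al_opp sw b; lia.
Qed.

Section Middle.
Variable c : 'I_n * bool.
Hypothesis cc : p (al (sopp c)) = (p (al c)).+1.

Let bcc : p (be (sopp c)) = (p (be c)).+1.
Proof. by have := pos_al_opp sw c; have := pos_be_opp sw c; lia. Qed.

Lemma middle_positive : ~~ c.2.
Proof.
have := max_no_relabel cc (or_intror erefl) (or_introl bcc).
by rewrite subscript_sopp; case: (c) => i [] //; rewrite /subscript /negative /mod_value /=; lia.
Qed.

(** Exchanging the middle letters [c] and [sopp c] alone lowers the word, since [c] is positive, but
    it prepares a second move at an earlier place that makes the result larger than [w]. *)
Let w1 := map_word (relabel c (sopp c)) w.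

Let sw1 : symmetric_sketch w1. Proof. exact: relabel_sketch. Qed.

Let ew1 : comb_equiv w w1.
Proof. by apply: (relabel_comb_equiv sw cc); [right|left]. Qed.

Lemma index_middle_relabel x : x.1 <> c -> x.1 <> sopp c -> index x w1 = p x.
Proof. by move=> h1 h2; apply: index_relabel_fix; rewrite ?soppK. Qed.

Let al_w1 : index (al (sopp c)) w1 = p (al c).
Proof.
rewrite (index_map_word (relabelK _ _)) relabel_al dswap_comm; [|exact: soppK|exact: sopp_neq].
by rewrite /dswap eqxx soppK.
Qed.

Let be_w1 : index (be (sopp c)) w1 = p (be c).
Proof.
rewrite (index_map_word (relabelK _ _)) relabel_be dswap_comm; [|exact: soppK|exact: sopp_neq].
by rewrite /dswap eqxx soppK.
Qed.

Lemma before_middle_fix x : (p x < p (al c))%N -> x.1 <> c /\ x.1 <> sopp c.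
Proof.
have h1 := pos_al_be sw c; have h2 := pos_al_be sw (sopp c).
by move=> xc; split=> E; move: xc; rewrite (letterP x) E; case: ifP; lia.
Qed.

(** In [w1] the letter after [be e] is the negative [al (sopp c)], an irrelevant neighbour, so the
    two can be exchanged and an alpha-letter moves up. *)
Lemma middle_no_beta e : p (al c) <> (p (be e)).+1.
Proof.
move=> ec; have [he hc he1] := max_cond1 ec.
have [ec1 ec2] : (be e).1 <> c /\ (be e).1 <> sopp c by apply: before_middle_fix; lia.
have ez : index (al (sopp c)) w1 = (index (be e) w1).+1.
  by rewrite al_w1 (index_middle_relabel ec1 ec2).
have irr : ~~ relevant (al (sopp c)) (be e).
  by rewrite /relevant /positive /negative /= hc !andbF.
have := max_w (swap_sketch sw1 ez irr) (comb_equiv_trans ew1 (swap_comb_equiv sw1 ez irr)).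
move=> /negP; apply; rewrite map_word_comp.
have tw := sketch_total sw.
apply: (sketch_lt_map_word (x := be e)) => //=; last first.
  rewrite relabel_fix ?soppK // /swap_letters /dswap eqxx.
  exact: key_lt_be_al.
move=> y ye; have {}ye : (p y < p (be e))%N by [].
have [yc1 yc2] : y.1 <> c /\ y.1 <> sopp c by apply: before_middle_fix; lia.
rewrite relabel_fix ?soppK // /swap_letters /dswap conjugate_be conjugate_al soppK.
have h1 := pos_be_opp sw (sopp e); have h2 := pos_al_opp sw c; have h3 := pos_al_be sw c.
rewrite soppK in h1.
rewrite ifN; last by apply/eqP => E; rewrite E ltnn in ye.
rewrite ifN; last by apply/eqP => E; apply: yc2; rewrite E.
rewrite ifN; last by apply/eqP => E; rewrite E in ye; lia.
by rewrite ifN //; apply/eqP => E; apply: yc1; rewrite E.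
Qed.

(** In [w1] the negative letters [al d] and [al (sopp c)] are adjacent, and so are their
    beta-letters; exchanging [d] with [sopp c] must not enlarge the word. *)
Lemma middle_pred d : p (al c) = (p (al d)).+1 -> d.2 -> p (be c) = (p (be d)).+1 ->
  sub (sopp c) < sub d.
Proof.
move=> dc hd bdc; have hc := middle_positive.
rewrite ltNge; apply/negP => le.
have [dc1 dc2] : d <> c /\ d <> sopp c by apply: (@before_middle_fix (al d)); lia.
have {le}lt : sub d < sub (sopp c).
  by rewrite lt_neqAle le andbT; apply/eqP => /subscript_inj.
have h1 : index (al (sopp c)) w1 = (index (al d) w1).+1.
  by rewrite al_w1 (index_middle_relabel (x := al d)).
have h2 : index (be (sopp c)) w1 = (index (be d) w1).+1.
  by rewrite be_w1 (index_middle_relabel (x := be d)).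
have hs : d.2 = (sopp c).2 by rewrite hd /= hc.
have := max_w (relabel_sketch d (sopp c) sw1)
  (comb_equiv_trans ew1 (relabel_comb_equiv sw1 h1 (or_introl hs) (or_introl h2))).
move=> /negP; apply; rewrite map_word_comp.
have tw := sketch_total sw.
apply: (sketch_lt_map_word (x := al d)) => //=; last first.
  by rewrite (relabel_fix (x := al d)) ?soppK // relabel_al /dswap eqxx key_lt_al.
move=> y yd; have {}yd : (p y < p (al d))%N by [].
have [yc1 yc2] : y.1 <> c /\ y.1 <> sopp c by apply: before_middle_fix; lia.
have h3 := pos_al_opp sw d; have h4 := pos_al_opp sw c; have h5 := pos_al_be sw d.
have h6 := pos_al_be sw (sopp d).
have [yd1 yd2] : y.1 <> d /\ y.1 <> sopp d.
  by split=> E; move: yd; rewrite (letterP y) E; case: ifP; lia.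
by rewrite relabel_fix ?soppK // relabel_fix ?soppK.
Qed.

End Middle.

Lemma max_condition3 : (2 <= n)%N -> condition3 w.
Proof.
move=> n2 x y z; have tw := sketch_total sw.
move=> /(kth_alphaP _ _ tw) [+ rd] /(kth_alphaP _ _ tw) [+ rc] /(kth_alphaP _ _ tw) [+ rs].
case: (alphaP x) rd => //= d rd _; case: (alphaP y) rc => //= c rc _.
case: (alphaP z) rs => //= s rs _.
have E : s = sopp c by apply: (rk_inj sw); have := rk_opp sw c; lia.
subst s; move=> ccons.
have cc : p (al (sopp c)) = (p (al c)).+1.
  have : (p (al c) < p (al (sopp c)))%N by rewrite -(rk_ltE sw); lia.
  by case/orP: ccons => /eqP; lia.
have dc : (p (al d) < p (al c))%N by rewrite -(rk_ltE sw); lia.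
have pdc : p (al c) = (p (al d)).+1.
  have h4 : ((p (al c)).-1 < 4 * n)%N by have := pos_lt sw (al c); lia.
  have [t ht] := pos_surj sw h4.
  case: (alphaP t) ht => m hm; last by case: (@middle_no_beta _ cc m); lia.
  suff E : m = d by rewrite -E; lia.
  apply: (rk_inj sw).
  have : (rk w m < rk w c)%N by rewrite (rk_ltE sw); lia.
  have : ~~ (rk w m < rk w d)%N by rewrite (rk_ltE sw); lia.
  by lia.
split; [by rewrite /consecutive /followed_by pdc eqxx|exact: (middle_positive cc)|].
move=> u v /(kth_betaP sw) [+ ru] /(kth_betaP sw) [+ rv]; rewrite /is_beta.
case: (alphaP u) ru => //= d' ru _; case: (alphaP v) rv => //= c' rv _.
have -> : d' = d by apply: (rk_inj sw); lia.
have -> : c' = c by apply: (rk_inj sw); lia.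
move=> hd /orP bcons; apply: middle_pred => //.
have : (p (be d) < p (be c))%N by rewrite -(pos_mono sw).
by case: bcons => /eqP; lia.
Qed.

Lemma max_ST_conditions : (2 <= n)%N -> ST_conditions w.
Proof.
move=> n2; split; [exact: max_condition1|exact: max_condition2|exact: max_condition3|].
exact: max_condition4.
Qed.

End Necessity.

(** * Realization of sketches *)

Section Values.
Context {R : realType} {n : nat}.
Implicit Types (w : word n) (x y : 'rV[R]_n) (a b : letter n) (k l : 'I_n * bool).

Lemma letter_value_conjugate x a : letter_value x (conjugate a) = - letter_value x a.
Proof. by case: a => [[i []] s]; rewrite /letter_value /negative /= ?opprK. Qed.

Lemma letter_value_be x k : letter_value x (be k) = letter_value x (al k) + 1.
Proof. by case: k => i []; rewrite /letter_value /negative /=; ring. Qed.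

Lemma subscript_conjugate a : subscript (conjugate a) = - subscript a.
Proof. by case: a => [[i []] s]; rewrite /subscript /negative /mod_value /= ?opprK. Qed.

Lemma sketch_regionP w x : total_order_word w ->
  sketch_region R w x <-> forall a b, before w a b -> letter_value x a < letter_value x b.
Proof.
move=> tw; rewrite /sketch_region /= sorted_map.
have tr : transitive (relpre (letter_value x) <%R) by move=> b a c /=; exact: lt_trans.
split=> [srt a b ab|h].
  by apply: (sorted_ltn_index tr srt) => //; exact: total_order_mem.
case E : (tval w) => [//|a0 s]; rewrite -E.
apply/(sortedP a0) => i iw; apply: h.
have uw := total_order_uniq tw.
by rewrite /before !index_uniq //; exact: ltn_trans iw.
Qed.

Lemma sketch_region_before w x a b : total_order_word w -> sketch_region R w x ->
  before w a b = (letter_value x a < letter_value x b).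
Proof.
move=> tw /(sketch_regionP _ tw) h.
have hba := h b a; have hab := h a b; move: hba hab; rewrite /before.
case: (ltngtP (index a w) (index b w)) => [_ _ /(_ isT) -> //|_ /(_ isT)|].
  by move=> h1 _; apply/esym/negbTE; rewrite -leNgt ltW.
by move=> /(index_injective tw) -> _ _; rewrite ltxx.
Qed.

Lemma seq_max_or_nil (L : seq R) :
  L = [::] \/ exists2 M, M \in L & forall u, u \in L -> u <= M.
Proof.
elim: L => [|u L [->|[M ML maxM]]]; first by left.
  by right; exists u; rewrite ?inE // => v; rewrite inE => /eqP ->.
right; exists (Num.max u M).
  by rewrite /Num.max; case: ifP; rewrite !inE ?eqxx ?ML ?orbT.
by move=> v; rewrite inE le_max => /orP [/eqP ->|/maxM ->]; rewrite ?lexx ?orbT.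
Qed.

Lemma exists_between (L U : seq R) : (forall u v, u \in L -> v \in U -> u < v) ->
  (* Negation turns the minimum of [U] into a maximum of [U']. *)
  exists t, (forall u, u \in L -> u < t) /\ (forall v, v \in U -> t < v).
Proof.
move=> LU; pose U' := [seq - u | u <- U].
have memU' v : v \in U -> - v \in U' by move=> vU; exact: map_f.
have [E|[M ML maxM]] := seq_max_or_nil L; have [E'|[m mU minm]] := seq_max_or_nil U'.
- exists 0; split=> [u|v]; first by rewrite E.
  by move=> /memU'; rewrite E'.
- exists (- m - 1); split=> [u|v]; first by rewrite E.
  by move=> /memU' /minm; lra.
- exists (M + 1); split=> [u /maxM|v]; first by lra.
  by move=> /memU'; rewrite E'.
- have [v vU mE] := mapP mU; have Mm := LU _ _ ML vU; exists ((M - m) / 2); split.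
    by move=> u /maxM; lra.
  by move=> u /memU' /minm; lra.
Qed.

Section Realization.
Variable w : word n.
Hypothesis sw : symmetric_sketch w.
Local Notation p a := (index a w).

(** The third property keeps room for the pending beta-letters: every value placed
    so far lies below the forced value of each of them. *)
Lemma realize_prefix m : (m <= 4 * n)%N -> exists v : letter n -> R,
  [/\ forall a b, (p a < p b)%N -> (p b < m)%N -> v a < v b,
      forall k, (p (be k) < m)%N -> v (be k) = v (al k) + 1
    & forall k a, (p (al k) < m)%N -> (m <= p (be k))%N -> (p a < m)%N -> v a < v (al k) + 1].
Proof.
elim: m => [|m IH] hm; first by exists (fun=> 0); split.
have {IH} [v [v1 v2 v3]] := IH (ltnW hm).
have [c pc] := pos_surj sw hm.
have lift a b (E : p a = p b) : a = b by exact: (pos_inj sw).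
case: (alphaP c) pc => k pk.
  (* A new alpha-letter needs a value above all placed values [L] and below the forced values [U] of
     the pending beta-letters. *)
  pose L := [seq v a | a <- enum {: letter n} & (p a < m)%N].
  pose U := [seq v (al l) + 1 | l <- enum {: 'I_n * bool} & (p (al l) < m)%N && (m <= p (be l))%N].
  have [t [Lt Ut]] : exists t, (forall u, u \in L -> u < t) /\ (forall v, v \in U -> t < v).
    apply: exists_between => u u' /mapP [a]; rewrite mem_filter => /andP [am _] ->.
    by move=> /mapP [l]; rewrite mem_filter => /andP [/andP [lm ml] _] ->; exact: v3.
  have {}Lt a : (p a < m)%N -> v a < t.
    by move=> am; apply/Lt/map_f; rewrite mem_filter am mem_enum.
  have {}Ut l : (p (al l) < m)%N -> (m <= p (be l))%N -> t < v (al l) + 1.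
    move=> lm ml; apply: Ut; apply/mapP; exists l => //.
    by rewrite mem_filter lm ml mem_enum.
  exists (fun a => if a == al k then t else v a); split.
  - move=> a b ab bm; case: eqP => [E|ak]; first by move: ab; rewrite E; lia.
    case: eqP => [E|bk]; first by apply: Lt; rewrite -pk -E.
    by apply: v1 => //; have : p b <> p (al k) by [move=> /lift]; lia.
  - move=> l lm; rewrite ifN; last by apply/eqP => /esym/al_be.
    have lm' : (p (be l) < m)%N.
      by have := @pos_al_be_neq _ _ sw k l; lia.
    rewrite ifN ?v2 //; apply/eqP => /al_inj E; subst l.
    by have := pos_al_be sw k; lia.
  - move=> l a lm ml am.
    have {}am : a = al k \/ (p a < m)%N.
      by have [E|ne] := pselect (p a = p (al k)); [left; exact: lift|right; lia].
    case: eqP am => [_ _|ak [//|am]]; case: (al l =P al k) => [E|lk].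
    + by lra.
    + by apply: Ut; [have : p (al l) <> p (al k) by [move=> /lift]|]; lia.
    + by have := Lt _ am; lra.
    + by apply: v3 => //; [have : p (al l) <> p (al k) by [move=> /lift]|]; lia.
(* The value of a beta-letter is forced; the third property puts it above all earlier values, and
   any beta-letter still pending has a later alpha-letter, hence a larger forced value. *)
exists (fun a => if a == be k then v (al k) + 1 else v a); split.
- move=> a b ab bm; case: eqP => [E|ak]; first by move: ab; rewrite E; lia.
  case: eqP => [E|bk].
    by apply: v3; rewrite -?pk ?pos_al_be // -E.
  by apply: v1 => //; have : p b <> p (be k) by [move=> /lift]; lia.
- move=> l lm; rewrite (introF (al l =P be k) (@al_be n l k)).
  case: eqP => [/be_inj -> //|lk]; apply: v2.
  by have : p (be l) <> p (be k) by [move=> /lift]; lia.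
- move=> l a lm ml am; rewrite (introF (al l =P be k) (@al_be n l k)).
  have kl : (p (al k) < p (al l))%N by rewrite (pos_mono sw); lia.
  have lm' : (p (al l) < m)%N by have := @pos_al_be_neq _ _ sw l k; lia.
  case: eqP => [_|ak]; first by have := v1 _ _ kl lm'; lra.
  apply: v3 => //; first by lia.
  by have : p a <> p (be k) by [move=> /lift]; lia.
Qed.

Lemma sketch_region_nonempty : exists x, sketch_region R w x.
Proof.
have [v [v1 v2 _]] := realize_prefix (leqnn _).
have tw := sketch_total sw; have [_ cw _ _] := sw.
(* Conjugation reverses the word, so this antisymmetric average is still increasing along it, and it
   keeps the gap 1 between [al k] and [be k]. *)
pose V a := (v a - v (conjugate a)) / 2.
have Vlt a b : before w a b -> V a < V b.
  move=> ab; have h1 := v1 _ _ ab (pos_lt sw b).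
  have h2 := v1 _ _ (cw _ _ ab) (pos_lt sw _); rewrite /V; lra.
have Vbe k : V (be k) = V (al k) + 1.
  rewrite /V conjugate_be conjugate_al !v2 ?(pos_lt sw) //; lra.
have Vconj a : V (conjugate a) = - V a by rewrite /V conjugateK; lra.
pose x : 'rV[R]_n := \row_i V (al (i, false)).
exists x; apply/(sketch_regionP _ tw) => a b ab.
suff E c : letter_value x c = V c by rewrite !E; exact: Vlt.
have Eal i : letter_value x (al (i, false)) = V (al (i, false)).
  by rewrite /letter_value /= mxE addr0.
have Ebe i : letter_value x (be (i, false)) = V (be (i, false)).
  by rewrite letter_value_be Eal Vbe.
case: (alphaP c) => -[i []] //.
  have -> : al (i, true) = conjugate (be (i, false)) by [].
  by rewrite letter_value_conjugate Ebe Vconj.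
have -> : be (i, true) = conjugate (al (i, false)) by [].
by rewrite letter_value_conjugate Eal Vconj.
Qed.

End Realization.
End Values.

(** * Regions of the Shi threshold arrangement *)

Lemma connected_segment (R : realType) (n : nat) (x y : 'rV[R]_n) :
  connected [set x + t *: (y - x) | t in `[0, 1]].
Proof.
(* Dimension 0 is treated apart: the space is a single point. *)
case: n x y => [|n] x y.
  have -> : [set x + t *: (y - x) | t in `[0 : R, 1]] = [set x].
    apply/seteqP; split=> [z [t _ <-]|z ->]; first by rewrite /= !thinmx0.
    by exists 0; rewrite ?scale0r ?addr0 //= in_itv /= lexx ler01.
  exact: connected1.
apply: connected_continuous_connected; first exact: segment_connected.
apply: continuous_subspaceT => t.
by apply: cvgD; [exact: cvg_cst|apply: cvgZr_tmp; exact: cvg_id].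
Qed.

Lemma convex_lt (R : realFieldType) (t u v u' v' : R) :
  0 <= t -> t <= 1 -> u < v -> u' < v' ->
  (1 - t) * u + t * u' < (1 - t) * v + t * v'.
Proof.
move=> t0 t1 uv uv'; have [->|tn0] := eqVneq t 0; first by lra.
apply: ler_ltD; first by rewrite ler_wpM2l ?subr_ge0 // ltW.
by rewrite ltr_pM2l // lt_neqAle eq_sym tn0.
Qed.

Section Regions.
Context {R : realType} {n : nat}.
Implicit Types (w : word n) (x y : 'rV[R]_n) (a b : letter n) (k l : 'I_n * bool).
Local Notation D := (arr_complement (ST_arr R n)).

Lemma relevantP a b : relevant a b ->
  exists i j s, [/\ i != j, a = (i, false, false) & b = (j, true, s)].
Proof.
case: a b => [[i s] u] [[j t] v] /and4P []; rewrite /positive /negative is_alphaE /=.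
by move=> /eqP <- /negbTE -> -> ij; exists i, j, v.
Qed.

(** The letters of a relevant pair have values [x_i] and [- x_j - s], which are equal exactly on the
    hyperplane [x_i + x_j = - s]. *)
Lemma ST_complementP x :
  D x <-> forall a b, relevant a b -> letter_value x a != letter_value x b.
Proof.
split=> [Dx a b /relevantP [i [j [s [ij -> ->]]]]|h].
  apply/eqP; rewrite /letter_value /negative /= addr0 => E; apply: Dx.
  have cs : - (s : nat)%:R = -1 :> R \/ - (s : nat)%:R = 0 :> R.
    by case: (s); [left|right; rewrite oppr0].
  have xij : x 0 i + x 0 j = - (s : nat)%:R by rewrite E; ring.
  case: (ltngtP i j) => [lt|gt|/val_inj E']; last by rewrite E' eqxx in ij.
    by exists [set z | z 0 i + z 0 j = - (s : nat)%:R] => //; exists i, j, (- (s : nat)%:R).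
  exists [set z | z 0 j + z 0 i = - (s : nat)%:R]; first by exists j, i, (- (s : nat)%:R).
  by rewrite /= addrC.
move=> [H [i [j [c [ij hc ->]]]] /= xij].
have ne : i != j by apply/eqP => E; rewrite E ltnn in ij.
have rel s : relevant (i, false, false) (j, true, s) by [].
have := h _ _ (rel true); have := h _ _ (rel false).
rewrite /letter_value /negative /= addr0.
by case: hc => hc /eqP h0 /eqP h1; [apply: h1|apply: h0]; rewrite /=; lra.
Qed.

Definition same_side x y :=
  forall a b, relevant a b ->
    (letter_value x a < letter_value x b) = (letter_value y a < letter_value y b).

Lemma letter_value_continuous a : continuous (fun x : 'rV[R]_n => letter_value x a).
Proof.
have c : continuous (fun x : 'rV[R]_n => x 0 a.1.1 + (a.2 : nat)%:R).
  by move=> x; exact: (cvgD (@coord_continuous R 1 n 0 a.1.1 x) (cvg_cst _)).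
move=> x; rewrite /letter_value; case: (negative a); last exact: c.
exact: cvgN (c x).
Qed.

Lemma letter_value_segment x y t a :
  letter_value (x + t *: (y - x)) a = (1 - t) * letter_value x a + t * letter_value y a.
Proof. by rewrite /letter_value; case: ifP => _; rewrite !mxE; ring. Qed.

(** A difference of relevant values is continuous and never 0 on a component, so its sign is
    constant; conversely a segment between points with the same signs keeps these signs. *)
Lemma connected_componentE x : D x ->
  connected_component D x = [set y | D y /\ same_side x y].
Proof.
move=> Dx; apply/seteqP; split=> [y Cy|y [Dy xy]].
  split; first exact: connected_component_sub Cy.
  move=> a b ab.
  pose g (z : 'rV[R]_n) := letter_value z b - letter_value z a.
  have cg : continuous g.
    by move=> z; exact: (cvgB (@letter_value_continuous b z) (@letter_value_continuous a z)).
  have : connected (g @` connected_component D x).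
    apply: connected_continuous_connected; first exact: component_connected.
    exact: continuous_subspaceT.
  move=> /connected_intervalP itv.
  have gx : (g @` connected_component D x) (g x).
    by exists x => //; exact: connected_component_refl.
  have gy : (g @` connected_component D x) (g y) by exists y.
  have g0 : ~ (g @` connected_component D x) 0.
    move=> [z /connected_component_sub /ST_complementP /(_ _ _ ab) /eqP zab].
    by rewrite /g => /eqP; rewrite subr_eq0 => /eqP /esym.
  have := itv _ _ gx gy 0; have := itv _ _ gy gx 0.
  have /eqP := (ST_complementP x).1 Dx _ _ ab.
  have /eqP := (ST_complementP y).1 ((@connected_component_sub _ D x) _ Cy) _ _ ab.
  rewrite /g => hy hx h1 h2.
  case: (ltgtP (letter_value x a) (letter_value x b)) hx => // lx _;
    case: (ltgtP (letter_value y a) (letter_value y b)) hy => // ly _; exfalso; apply: g0.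
    by apply: h1; lra.
  by apply: h2; lra.
apply: (@connected_component_max _ _ [set x + t *: (y - x) | t in `[0, 1]]).
- by exists 0; rewrite ?scale0r ?addr0 //= in_itv /= lexx ler01.
- move=> z [t t01 <-]; have /andP [t0 t1] : 0 <= t <= 1 by move: t01; rewrite /= in_itv.
  apply/ST_complementP => a b ab; rewrite !letter_value_segment.
  have := xy _ _ ab; have := (ST_complementP x).1 Dx _ _ ab.
  have := (ST_complementP y).1 Dy _ _ ab.
  case: (ltgtP (letter_value y a) (letter_value y b)) => // ly _;
    case: (ltgtP (letter_value x a) (letter_value x b)) => // lx _ _.
    by rewrite lt_eqF // convex_lt.
  by rewrite gt_eqF // convex_lt.
- exact: connected_segment.
- by exists 1; rewrite ?scale1r ?subrKC //= in_itv /= lexx ler01.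
Qed.

End Regions.

(** * A symmetric sketch from any point *)

Section SketchOfPoint.
Context {R : realType} {n : nat}.
Variable x : 'rV[R]_n.
Implicit Types (a b : letter n) (k l : 'I_n * bool).

(** Breaking ties by subscript makes even a point on hyperplanes of [C_n] yield a
    symmetric sketch, so that no perturbation to a generic point is needed. *)
Definition value_le a b : bool :=
  (letter_value x a < letter_value x b) ||
  (letter_value x a == letter_value x b) && (subscript a <= subscript b).

Lemma value_le_total : total value_le.
Proof.
move=> a b; rewrite /value_le.
by case: (ltgtP (letter_value x a) (letter_value x b)) => //= _; exact: le_total.
Qed.

Lemma value_le_trans : transitive value_le.
Proof.
move=> b a c; rewrite /value_le.
case/orP => [ab|/andP [/eqP -> sab]]; case/orP => [bc|/andP [/eqP <- sbc]].
- by rewrite (lt_trans ab bc).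
- by rewrite ab.
- by rewrite bc.
- by rewrite eqxx (le_trans sab sbc) orbT.
Qed.

Lemma value_le_anti : antisymmetric value_le.
Proof.
move=> a b; rewrite /value_le.
case: (ltgtP (letter_value x a) (letter_value x b)) => //= E /le_anti.
move: E; case: (alphaP a) => k; case: (alphaP b) => l; rewrite ?letter_value_be => E /subscript_inj /= kl.
- by rewrite kl.
- by subst l; exfalso; lra.
- by subst l; exfalso; lra.
- by rewrite kl.
Qed.

(** Conjugation negates both the value and the subscript, so the tie-break is reversed along with
    the order of values. *)
Lemma value_le_conjugate a b : value_le a b -> value_le (conjugate b) (conjugate a).
Proof.
rewrite /value_le !letter_value_conjugate !subscript_conjugate ltrN2 lerN2.
by rewrite (inj_eq oppr_inj) [letter_value x b == _]eq_sym.
Qed.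

Lemma size_sort_letters : size (sort value_le (enum {: letter n})) == (4 * n)%N.
Proof. by rewrite size_sort -cardE card_letter. Qed.

Definition sketch_of_point : word n := Tuple size_sort_letters.

Lemma total_sketch_of_point : total_order_word sketch_of_point.
Proof.
move=> a; rewrite /= (permP (permEl (perm_sort _ _))) count_uniq_mem ?enum_uniq //.
by rewrite mem_enum.
Qed.

Lemma before_sketch_of_point a b :
  before sketch_of_point a b = (a != b) && value_le a b.
Proof.
have tw := total_sketch_of_point.
have srt : sorted value_le sketch_of_point by apply: sort_sorted; exact: value_le_total.
have ix c d : before sketch_of_point c d -> value_le c d.
  by apply: (sorted_ltn_index value_le_trans srt) => //; exact: total_order_mem.
have [->|ne] := eqVneq; first by rewrite /before ltnn.
apply/idP/idP => [/ix //|le].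
rewrite /before ltn_neqAle; apply/andP; split.
  by apply: contra ne => /eqP /(index_injective tw) ->.
rewrite leqNgt; apply/negP => /ix ge.
by rewrite (value_le_anti (introT andP (conj le ge))) eqxx in ne.
Qed.

Lemma sketch_of_point_symmetric : symmetric_sketch sketch_of_point.
Proof.
apply/sketchE; split; first exact: total_sketch_of_point.
- move=> a b; rewrite !before_sketch_of_point => /andP [ab /value_le_conjugate ->].
  by rewrite (inj_eq (inv_inj conjugateK)) eq_sym ab.
- move=> k l; rewrite !before_sketch_of_point => /andP [kl].
  rewrite /value_le !letter_value_be ltrD2r (inj_eq (addIr _)) => ->.
  by rewrite andbT; apply: contra kl => /eqP /be_inj ->.
- move=> k; rewrite before_sketch_of_point /value_le letter_value_be ltrDl ltr01 andbT.
  by apply/eqP => /al_be.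
Qed.

Lemma before_sketch_of_point_relevant a b :
  arr_complement (ST_arr R n) x -> relevant a b ->
  before sketch_of_point a b = (letter_value x a < letter_value x b).
Proof.
move=> /ST_complementP Dx ab; have ne := Dx _ _ ab.
rewrite before_sketch_of_point /value_le (negbTE ne) /= orbF.
by rewrite (_ : a != b) //; apply: contra ne => /eqP ->.
Qed.

End SketchOfPoint.

(** * Sketches, regions and the bijection *)

Section Main.
Context {R : realType} {n : nat}.
Implicit Types (w : word n) (x y : 'rV[R]_n).
Local Notation D := (arr_complement (ST_arr R n)).

(** For a symmetric sketch this is the region of [ST_n] containing its sketch region; it provides
    the bijection. *)
Definition ST_cell w : set 'rV[R]_n :=
  [set y | D y /\ forall a b, relevant a b ->
     before w a b = (letter_value y a < letter_value y b)].

Lemma sketch_region_cell w : total_order_word w -> sketch_region R w `<=` ST_cell w.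
Proof.
move=> tw x xw; have bx a b := sketch_region_before a b tw xw; split => //.
apply/ST_complementP => a b ab; apply/eqP => E.
have := bx a b; have := bx b a; rewrite E ltxx /before.
case: (ltngtP (index a w) (index b w)) => // /(index_injective tw) Eab _ _.
by move: ab; rewrite Eab => /and4P [_ _ _]; rewrite eqxx.
Qed.

Lemma ST_cell_component w x : ST_cell w x -> ST_cell w = connected_component D x.
Proof.
move=> [Dx wx]; rewrite connected_componentE //; apply/seteqP; split=> y [Dy wy]; split=> // a b ab.
  by rewrite -wx // -wy.
by rewrite wx // wy.
Qed.

Lemma ST_cell_region w : symmetric_sketch w -> regions (ST_arr R n) (ST_cell w).
Proof.
move=> sw; have [x xw] := @sketch_region_nonempty R n w sw.
have wx := sketch_region_cell (sketch_total sw) xw.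
by exists x; [case: wx|exact: ST_cell_component].
Qed.

Lemma comb_equiv_cell w w' : comb_equiv w w' -> ST_cell w = ST_cell w'.
Proof.
move=> e; apply/seteqP; split=> y [Dy wy]; split=> // a b ab; first by rewrite -e // wy.
by rewrite e // wy.
Qed.

Lemma cell_comb_equiv w w' x : ST_cell w x -> ST_cell w' x -> comb_equiv w w'.
Proof. by move=> [_ wx] [_ wx'] a b ab; rewrite wx // wx'. Qed.

Lemma ST_equivalentP w w' : symmetric_sketch w -> symmetric_sketch w' ->
  ST_equivalent R w w' <-> comb_equiv w w'.
Proof.
move=> sw sw'; have tw := sketch_total sw; have tw' := sketch_total sw'.
split=> [[_ [x Dx ->] [h h']]|e].
  have [y yw] := @sketch_region_nonempty R n w sw; have [y' yw'] := @sketch_region_nonempty R n w' sw'.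
  have := h' _ yw'; have := h _ yw; rewrite connected_componentE // => -[_ xy] [_ xy'] a b ab.
  rewrite (sketch_region_before a b tw yw) (sketch_region_before a b tw' yw').
  by rewrite -xy // xy'.
exists (ST_cell w); first exact: ST_cell_region.
by split; [|rewrite (comb_equiv_cell e)]; exact: sketch_region_cell.
Qed.

Lemma ST_maximalP w : symmetric_sketch w ->
  ST_maximal R w <-> (forall w', symmetric_sketch w' -> comb_equiv w w' -> ~~ sketch_lt w w').
Proof.
move=> sw; split=> [max w' sw' e|max w' sw' e ne].
  have [->|ne] := pselect (w' = w); first by rewrite /sketch_lt ltxx.
  by rewrite sketch_lt_asym // max //; exact/ST_equivalentP.
have [//|lt] := sketch_lt_total ne.
by have := max _ sw' ((ST_equivalentP sw sw').1 e); rewrite lt.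
Qed.

Lemma comb_equiv_sym w w' : comb_equiv w w' -> comb_equiv w' w.
Proof. by move=> e a b ab; rewrite e. Qed.

(** There are finitely many words and their order is total, so each equivalence class has a greatest
    sketch. *)
Lemma exists_maximal w : symmetric_sketch w -> exists m,
  [/\ symmetric_sketch m, comb_equiv w m &
     forall w', symmetric_sketch w' -> comb_equiv m w' -> ~~ sketch_lt m w'].
Proof.
move=> sw; pose P v := `[< symmetric_sketch v /\ comb_equiv w v >].
have Pw : P w by apply/asboolP.
pose key (v : word n) : seqlexi (bool *l int) := [seq letter_key a | a <- v].
case: (@Order.TotalTheory.arg_maxP _ _ _ w P key Pw) => m /asboolP [sm em] maxm.
exists m; split=> // w' sw' e; rewrite /sketch_lt -leNgt; apply: maxm.
by apply/asboolP; split=> //; exact: comb_equiv_trans em e.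
Qed.

End Main.

Theorem theorem7p7 (R : realType) (n : nat) (hn : (2 <= n)%N) :
  (forall w : word n, symmetric_sketch w ->
     (ST_maximal R w <-> ST_conditions w)) /\
  (exists f : word n -> set 'rV[R]_n,
     set_bij [set w | symmetric_sketch w /\ ST_conditions w]
             (regions (ST_arr R n)) f /\
     (forall w : word n, symmetric_sketch w -> ST_conditions w ->
        sketch_region R w `<=` f w)).
Proof.
split=> [w sw|].
  rewrite (ST_maximalP sw); split; first by move=> max; exact: max_ST_conditions.
  by move=> hw w' sw' e; exact: not_sketch_lt.
exists ST_cell; split; last by move=> w sw _; exact/sketch_region_cell/sketch_total.
split.
- by move=> w [sw _]; exact: ST_cell_region.
- move=> w w'; rewrite !inE => -[sw hw] [sw' hw'] E.
  have [x xw] := @sketch_region_nonempty R n w sw.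
  have wx := sketch_region_cell (sketch_total sw) xw.
  have e : comb_equiv w w' by apply: (cell_comb_equiv wx); rewrite -E.
  (* Equivalent sketches that both satisfy (1)-(4) cannot exceed each other, so they are equal. *)
  apply: contrapT => /sketch_lt_total [lt|lt].
    by have := not_sketch_lt sw sw' hw e hn; rewrite lt.
  by have := not_sketch_lt sw' sw hw' (comb_equiv_sym e) hn; rewrite lt.
- move=> _ [x Dx ->].
  (* A preimage of the region of [x] is the greatest sketch equivalent to the one read off at
     [x]. *)
  have [m [sm em maxm]] := exists_maximal (sketch_of_point_symmetric x).
  exists m; first by split=> //; exact: max_ST_conditions.
  apply: ST_cell_component; rewrite -(comb_equiv_cell em); split=> // a b ab.
  exact: before_sketch_of_point_relevant.
Qed.
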